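(* Let $L=\mathbb{Q}(i)$ and let $\sigma$ be the nontrivial automorphism in $\mathrm{Gal}(L/\mathbb{Q})$. Let $n\ge3$ be an odd integer, let $q$ be an arbitrary nondegenerate $\sigma$-Hermitian form on $L^n$, let $\widetilde{G}=\mathrm{SU}_n(q)$ be the algebraic $\mathbb{Q}$-group associated with the special unitary group of $q$, and let $G$ be the corresponding adjoint group. Set $S=\{v_\infty\}\cup\{v_2\}\cup\{v_p\mid p\text{ prime},\ p\equiv3\ (\mathrm{mod}\ 4)\}$. Then $$[G(\mathbb{A}_S):\overline{G(\mathbb{Q})}^{(S)}]=\infty,$$ and thus $G$ does not have almost strong approximation with respect to $S$.
   Context: $v_\infty$ is the archimedean valuation of $\mathbb{Q}$ and $v_p$ the $p$-adic valuation. For a set $S$ of valuations of $\mathbb{Q}$, $\mathbb{A}_S=\mathbb{A}_{\mathbb{Q},S}$ is the ring of $S$-adeles: the restricted topological product of the completions $\mathbb{Q}_v$ for $v\notin S$ with respect to the valuation rings $\mathbb{Z}_p\subset\mathbb{Q}_p$ (so for the set $S$ in the claim, only primes $p\equiv1\ (\mathrm{mod}\ 4)$ occur). $G(\mathbb{A}_S)$ carries the $S$-adelic topology, $G(\mathbb{Q})$ is diagonally embedded in it, and $\overline{G(\mathbb{Q})}^{(S)}$ is its closure. $G$ has almost strong approximation with respect to $S$ if $[G(\mathbb{A}_S):\overline{G(\mathbb{Q})}^{(S)}]<\infty$. The adjoint group $G$ is the quotient of $\widetilde{G}$ by its (scheme-theoretic) center. *)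

(* Defs.v *)
From HB Require Import structures.
From mathcomp Require Import all_boot all_order all_algebra.
From mathcomp Require Import all_classical topology.
From mathcomp Require Import ring.
From mathcomp Require mpoly.
(* The notations of mpoly clash with those of mathcomp-analysis. *)
Import (canonicals, coercions) mpoly.

Set Implicit Arguments.
Unset Strict Implicit.
Unset Printing Implicit Defensive.

Import Order.TTheory GRing.Theory Num.Theory.
Local Open Scope classical_set_scope.
Local Open Scope ring_scope.

(* R[X]/(X^2 + 1); for a Q-algebra R this is L (x)_Q R with L = Q(i). *)
Record gauss (R : Type) := Gauss { gre : R; gim : R }.

Section GaussChoice.
Variable R : Type.
Definition pair_of_gauss (x : gauss R) := (gre x, gim x).
Definition gauss_of_pair (x : R * R) := Gauss x.1 x.2.
Lemma pair_of_gaussK : cancel pair_of_gauss gauss_of_pair.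
Proof. by case. Qed.
End GaussChoice.

HB.instance Definition _ (R : choiceType) :=
  Choice.copy (gauss R) (can_type (@pair_of_gaussK R)).

Section GaussRing.
Variable R : comNzRingType.
Implicit Types x y z : gauss R.

Definition gauss0 : gauss R := Gauss 0 0.
Definition gauss1 : gauss R := Gauss 1 0.
Definition gauss_opp x := Gauss (- gre x) (- gim x).
Definition gauss_add x y := Gauss (gre x + gre y) (gim x + gim y).
Definition gauss_mul x y :=
  Gauss (gre x * gre y - gim x * gim y) (gre x * gim y + gim x * gre y).

Lemma gauss_addA : associative gauss_add.
Proof. by move=> x y z; congr Gauss; rewrite /= addrA. Qed.
Lemma gauss_addC : commutative gauss_add.
Proof. by move=> x y; congr Gauss; rewrite /= addrC. Qed.
Lemma gauss_add0 : left_id gauss0 gauss_add.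
Proof. by case=> a b; congr Gauss; rewrite /= add0r. Qed.
Lemma gauss_addN : left_inverse gauss0 gauss_opp gauss_add.
Proof. by case=> a b; congr Gauss; rewrite /= addNr. Qed.
HB.instance Definition _ := GRing.isZmodule.Build (gauss R)
  gauss_addA gauss_addC gauss_add0 gauss_addN.

Lemma gauss_mulC : commutative gauss_mul.
Proof.
by move=> [a b] [c d]; congr Gauss; rewrite /=; ring.
Qed.
Lemma gauss_mulA : associative gauss_mul.
Proof.
by move=> [a b] [c d] [e f]; congr Gauss; rewrite /=; ring.
Qed.
Lemma gauss_mul1 : left_id gauss1 gauss_mul.
Proof. by case=> a b; congr Gauss; rewrite /= !(mul1r, mul0r, subr0, addr0). Qed.
Lemma gauss_mulDl : left_distributive gauss_mul +%R.
Proof.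
by move=> [a b] [c d] [e f]; congr Gauss; rewrite /=; ring.
Qed.
Lemma gauss1_neq0 : gauss1 != 0.
Proof. by apply/eqP => -[/eqP]; rewrite oner_eq0. Qed.
HB.instance Definition _ := GRing.Zmodule_isComNzRing.Build (gauss R)
  gauss_mulA gauss_mulC gauss_mul1 gauss_mulDl gauss1_neq0.

Definition gauss_conj x : gauss R := Gauss (gre x) (- gim x).

Lemma gauss_conj_additive : zmod_morphism gauss_conj.
Proof. by move=> x y; congr Gauss; rewrite /= opprD. Qed.
HB.instance Definition _ := GRing.isZmodMorphism.Build (gauss R) (gauss R)
  gauss_conj gauss_conj_additive.
Lemma gauss_conj_multiplicative : monoid_morphism gauss_conj.
Proof.
split=> [|x y]; congr Gauss; rewrite /= ?oppr0 // ?mulrNN //.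
by rewrite mulrN mulNr opprD.
Qed.
HB.instance Definition _ := GRing.isMonoidMorphism.Build (gauss R) (gauss R)
  gauss_conj gauss_conj_multiplicative.

End GaussRing.

Section GaussField.
Variable F : realFieldType.

Definition gauss_inv (x : gauss F) : gauss F :=
  let n := gre x ^+ 2 + gim x ^+ 2 in Gauss (gre x / n) (- gim x / n).

Lemma gauss_mulV (x : gauss F) : x != 0 -> gauss_inv x * x = 1.
Proof.
case: x => a b xN0.
have nN0 : a ^+ 2 + b ^+ 2 != 0.
  apply: contra xN0; rewrite paddr_eq0 ?sqr_ge0 // !expf_eq0 /=.
  by case/andP => /eqP-> /eqP->.
congr Gauss; rewrite /= !mulNr ?opprK ![_ / _ * _]mulrAC.
  by rewrite -mulrDl -!expr2 mulfV.
by rewrite (mulrC b) subrr.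
Qed.
Lemma gauss_inv0 : gauss_inv 0 = 0.
Proof. by congr Gauss; rewrite /= ?oppr0 mul0r. Qed.
HB.instance Definition _ := GRing.ComNzRing_isField.Build (gauss F)
  gauss_mulV gauss_inv0.

End GaussField.

Definition gauss_map (R R' : Type) (h : R -> R') (x : gauss R) : gauss R' :=
  Gauss (h (gre x)) (h (gim x)).

Definition L := gauss rat.
HB.instance Definition _ := GRing.Field.on L.
Definition sigma : L -> L := @gauss_conj rat.
HB.instance Definition _ := GRing.RMorphism.on sigma.

Section SpecialUnitary.
Variables (n : nat) (q : {hermitian 'rV[L]_n for false & sigma}).

Definition gram (R : comAlgType rat) : 'M[gauss R]_n :=
  map_mx (gauss_map (in_alg R)) (matrix_of_form q).

(* g acts on row vectors by v |-> v *m g *)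
Definition SU (R : comAlgType rat) : set 'M[gauss R]_n :=
  [set g | g *m gram R *m (map_mx (@gauss_conj R) g)^T = gram R /\ \det g = 1].

(* The scheme-theoretic center: elements that centralize after every base
   change. *)
Definition SU_center (R : comAlgType rat) : set 'M[gauss R]_n :=
  [set z | SU z /\
    forall (R' : comAlgType rat) (h : {lrmorphism R -> R'}) (g : 'M_n),
      @SU R' g ->
      map_mx (gauss_map h) z *m g = g *m map_mx (gauss_map h) z].

Lemma SU1 (R : comAlgType rat) : @SU R 1%:M.
Proof. by split; rewrite ?det1 // mul1mx map_mx1 trmx1 mulmx1. Qed.

Lemma SUM (R : comAlgType rat) (g h : 'M_n) :
  @SU R g -> SU h -> SU (g *m h).
Proof.
move=> [gU g1] [hU h1]; split; last by rewrite det_mulmx g1 h1 mulr1.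
by rewrite map_mxM trmx_mul !mulmxA -(mulmxA g h) -(mulmxA g) hU.
Qed.

(* Real and imaginary parts of the matrix entries: an R-point of SU_n(q) is
   determined by 2 n^2 elements of R. *)
Definition coord_index := (bool * 'I_n * 'I_n)%type.
Definition coord (R : comAlgType rat) (g : 'M[gauss R]_n)
    (k : 'I_#|{: coord_index}|) : R :=
  let: (im, i, j) := enum_val k in if im then gim (g i j) else gre (g i j).

Definition coord_poly := mpoly.mpoly #|{: coord_index}| rat.
HB.instance Definition _ := GRing.ComNzRing.on coord_poly.

Definition eval_poly (R : comAlgType rat) (g : 'M[gauss R]_n)
  (P : coord_poly) : R := mpoly.mmap (in_alg R) (coord g) P.

Lemma eval_poly_additive (R : comAlgType rat) (g : 'M[gauss R]_n) :
  zmod_morphism (eval_poly g).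
Proof. exact: mpoly.mmap_is_additive. Qed.
HB.instance Definition _ (R : comAlgType rat) (g : 'M[gauss R]_n) :=
  GRing.isZmodMorphism.Build coord_poly R (@eval_poly R g)
    (eval_poly_additive g).
Lemma eval_poly_multiplicative (R : comAlgType rat) (g : 'M[gauss R]_n) :
  monoid_morphism (eval_poly g).
Proof. by have [? ?] := mpoly.mmap_is_multiplicative (coord g) (in_alg R). Qed.
HB.instance Definition _ (R : comAlgType rat) (g : 'M[gauss R]_n) :=
  GRing.isMonoidMorphism.Build coord_poly R (@eval_poly R g)
    (eval_poly_multiplicative g).

(* The ideal of SU_n(q); vanishing is tested on points in all (nonzero)
   commutative Q-algebras, so this is the ideal generated by the defining
   equations and not merely its radical. *)
Definition SU_ideal : {pred coord_poly} := fun P =>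
  `[< forall (R : comAlgType rat) (g : 'M[gauss R]_n),
        SU g -> eval_poly g P = 0 >].

Lemma SU_ideal_closed : idealr_closed SU_ideal.
Proof.
split; first by apply/asboolP => R g _; rewrite rmorph0.
  apply/negP => /asboolP/(_ rat^o _ (SU1 _))/eqP.
  by rewrite rmorph1 oner_eq0.
move=> a u v /asboolP u0 /asboolP v0; apply/asboolP => R g gU.
by rewrite rmorphD rmorphM /= u0 ?v0 // mulr0 addr0.
Qed.
HB.instance Definition _ := isIdealr.Build coord_poly SU_ideal SU_ideal_closed.

Definition SU_ring := {ideal_quot SU_ideal}.
HB.instance Definition _ := GRing.ComNzRing.on SU_ring.

Definition evalSU (R : comAlgType rat) (g : 'M[gauss R]_n) (f : SU_ring) : R :=
  eval_poly g (repr f).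

Lemma evalSU_pi (R : comAlgType rat) (g : 'M[gauss R]_n) (P : coord_poly) :
  SU g -> evalSU g (\pi_SU_ring P)%qT = eval_poly g P.
Proof.
move=> gU; apply/eqP; rewrite -subr_eq0 /evalSU -rmorphB; apply/eqP.
suff /asboolP : SU_ideal (repr (\pi_SU_ring P)%qT - P) by apply.
rewrite -[SU_ideal _]/(_ \in SU_ideal) Quotient.idealrBE; apply/eqP.
exact: reprK.
Qed.

Lemma evalSUB (R : comAlgType rat) (g : 'M[gauss R]_n) (f f' : SU_ring) :
  SU g -> evalSU g (f - f') = evalSU g f - evalSU g f'.
Proof.
move=> gU; rewrite -[f]reprK -[f']reprK.
by rewrite -[_ - _](rmorphB \pi_SU_ring%qT) !evalSU_pi ?rmorphB.
Qed.

Lemma evalSUM (R : comAlgType rat) (g : 'M[gauss R]_n) (f f' : SU_ring) :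
  SU g -> evalSU g (f * f') = evalSU g f * evalSU g f'.
Proof.
move=> gU; rewrite -[f]reprK -[f']reprK.
by rewrite -[_ * _](rmorphM \pi_SU_ring%qT) !evalSU_pi ?rmorphM.
Qed.

Lemma evalSU1 (R : comAlgType rat) (g : 'M[gauss R]_n) :
  SU g -> evalSU g 1 = 1.
Proof.
by move=> gU; rewrite -[1](rmorph1 \pi_SU_ring%qT) evalSU_pi ?rmorph1.
Qed.

(* The invariants of SU_ring under translation by the center, i.e. the
   coordinate ring of the quotient of SU_n(q) by its center. *)
Definition adjoint_pred : {pred SU_ring} := fun f =>
  `[< forall (R : comAlgType rat) (g z : 'M[gauss R]_n),
        SU g -> SU_center z -> evalSU (g *m z) f = evalSU g f >].

Lemma adjoint_pred_closed : subring_closed adjoint_pred.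
Proof.
split=> [|f f' /asboolP fP /asboolP f'P|f f' /asboolP fP /asboolP f'P];
  apply/asboolP => R g z gU zZ; have gzU := SUM gU zZ.1.
- by rewrite !evalSU1.
- by rewrite !evalSUB // fP ?f'P.
- by rewrite !evalSUM // fP ?f'P.
Qed.
HB.instance Definition _ :=
  GRing.isSubringClosed.Build SU_ring adjoint_pred adjoint_pred_closed.

Record adjoint_ring :=
  AdjointFun { adjoint_val :> SU_ring; _ : adjoint_val \in adjoint_pred }.
HB.instance Definition _ := [isSub for adjoint_val].
HB.instance Definition _ := [Choice of adjoint_ring by <:].
HB.instance Definition _ := [SubChoice_isSubComNzRing of adjoint_ring by <:].

(* The A-points of G = SU_n(q) / center, for a commutative Q-algebra A.  Ring
   morphisms between Q-algebras are automatically Q-linear. *)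
Definition adjoint_group (A : comPzRingType) := {rmorphism adjoint_ring -> A}.

(* The graph of the group law of G(A): [x12] is the product of [x1] and [x2],
   i.e. x12 = (x1 (x) x2) \o Delta, where Delta is the comultiplication of the
   Hopf algebra adjoint_ring.  The equation Delta f = \sum_i a i (x) b i is
   stated as an identity of functions on SU x SU, which is equivalent since
   SU_ring (x) SU_ring is the ring of regular functions on SU x SU. *)
Definition is_adjoint_mul (A : comPzRingType) (x1 x2 x12 : adjoint_group A) :=
  forall (f : adjoint_ring) (m : nat) (a b : 'I_m -> adjoint_ring),
    (forall (R : comAlgType rat) (g h : 'M[gauss R]_n), SU g -> SU h ->
       evalSU (g *m h) f = \sum_(i < m) evalSU g (a i) * evalSU h (b i)) ->
    x12 f = \sum_(i < m) x1 (a i) * x2 (b i).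

(* Cosets are subsets of G(A), so that equal cosets are identified. *)
Definition left_coset (A : comPzRingType) (H : set (adjoint_group A))
    (x : adjoint_group A) : set (adjoint_group A) :=
  [set y | exists2 h, H h & is_adjoint_mul x h y].

(* [G(A) : H] is the cardinality of this set. *)
Definition left_cosets (A : comPzRingType) (H : set (adjoint_group A)) :
    set (set (adjoint_group A)) :=
  [set left_coset H x | x in [set: adjoint_group A]].


End SpecialUnitary.

Record prime_number := Prime { prime_val :> nat; prime_valP : prime prime_val }.
HB.instance Definition _ := [isSub for prime_val].
HB.instance Definition _ := [Countable of prime_number by <:].

Section Padic.
Variable p : prime_number.

Definition padic_val (x : rat) : int :=
  (logn p `|numq x|)%:Z - (logn p `|denq x|)%:Z.

(* v_p x >= k, with v_p 0 = +oo *)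
Definition padic_ge (k : int) (x : rat) : bool :=
  (x == 0) || (k <= padic_val x).

Let p_gt0 : (0 < p)%N. Proof. exact: prime_gt0 (prime_valP p). Qed.
Let p_neq0 : (p : nat)%:R != 0 :> rat.
Proof. by rewrite pnatr_eq0 -lt0n. Qed.

Lemma padic_val_frac (a b : int) : a != 0 -> b != 0 ->
  padic_val (a%:~R / b%:~R) = (logn p `|a|)%:Z - (logn p `|b|)%:Z.
Proof.
move=> a0 b0; rewrite /padic_val; set x := _ / _.
have x0 : x != 0 by rewrite mulf_neq0 ?invr_eq0 ?intr_eq0.
have : numq x * b = a * denq x.
  apply: (@intr_inj rat); rewrite !rmorphM /=.
  by rewrite numqE /x mulrAC mulfVK ?intr_eq0.
move/(congr1 absz); rewrite !abszM => /(congr1 (logn p)).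
rewrite !lognM ?absz_gt0 ?numq_eq0 ?denq_neq0 // => E.
apply/eqP; rewrite subr_eq addrAC eq_sym subr_eq -!PoszD eqz_nat.
by rewrite E.
Qed.

Lemma padic_val1 : padic_val 1 = 0.
Proof. by have := @padic_val_frac 1 1 isT isT; rewrite divr1 subrr. Qed.

Lemma padic_valM x y : x != 0 -> y != 0 ->
  padic_val (x * y) = padic_val x + padic_val y.
Proof.
move=> x0 y0; rewrite -{1}[x]divq_num_den -{1}[y]divq_num_den mulf_div.
rewrite -!rmorphM padic_val_frac ?mulf_neq0 ?numq_eq0 ?denq_neq0 //.
rewrite !abszM !lognM ?absz_gt0 ?numq_eq0 ?denq_neq0 //.
by rewrite /padic_val !PoszD opprD addrACA.
Qed.

Lemma padic_valV x : x != 0 -> padic_val x^-1 = - padic_val x.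
Proof.
move=> x0; apply/eqP; rewrite -addr_eq0; apply/eqP.
by rewrite -(padic_valM (invr_neq0 x0) x0) mulVf ?padic_val1.
Qed.

Lemma padic_ge0 k : padic_ge k 0. Proof. by rewrite /padic_ge eqxx. Qed.

Lemma padic_geN k x : padic_ge k (- x) = padic_ge k x.
Proof. by rewrite /padic_ge oppr_eq0 /padic_val numqN denqN abszN. Qed.

Lemma padic_geM k l x y :
  padic_ge k x -> padic_ge l y -> padic_ge (k + l) (x * y).
Proof.
have [->|x0] := eqVneq x 0; first by rewrite mul0r padic_ge0.
have [->|y0] := eqVneq y 0; first by rewrite mulr0 padic_ge0.
rewrite /padic_ge mulf_eq0 (negPf x0) (negPf y0) /= => ? ?.
by rewrite padic_valM // lerD.
Qed.

Lemma padic_ge_le k l x : l <= k -> padic_ge k x -> padic_ge l x.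
Proof.
move=> lk /orP[/eqP->|/(le_trans lk) h]; first exact: padic_ge0.
by rewrite /padic_ge h orbT.
Qed.

Lemma padic_geD0 x y : padic_ge 0 x -> padic_ge 0 y -> padic_ge 0 (x + y).
Proof.
have ge0P z : z != 0 -> padic_ge 0 z = ~~ (p %| `|denq z|)%N.
  move=> z0; rewrite /padic_ge (negPf z0) /= /padic_val subr_ge0 lez_nat.
  have := coprime_num_den z; rewrite /coprime => cop.
  case: (boolP (p %| `|denq z|)%N) => [pd|pNd]; last first.
    by rewrite (_ : logn p `|denq z| = 0%N) // lognE (negPf pNd) !andbF.
  have pNn : ~~ (p %| `|numq z|)%N.
    apply/negP => pn; have := prime_gt1 (prime_valP p).
    by have := dvdn_gcd p `|numq z| `|denq z|; rewrite pn pd (eqP cop) dvdn1 => /eqP ->.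
  rewrite [logn p `|numq z|]lognE (negPf pNn) !andbF leqn0.
  by apply/negbTE; rewrite -lt0n logn_gt0 mem_primes prime_valP pd absz_gt0 denq_neq0.
have [->|x0] := eqVneq x 0; first by rewrite add0r.
have [->|y0] := eqVneq y 0; first by rewrite addr0.
have [->|xy0] := eqVneq (x + y) 0; first by rewrite padic_ge0.
rewrite !ge0P // => px py.
have E : numq (x + y) * (denq x * denq y)
       = (numq x * denq y + numq y * denq x) * denq (x + y).
  apply: (@intr_inj rat); rewrite !(rmorphM, rmorphD) /=.
  rewrite !numqE; ring.
have /(congr1 absz) := E; rewrite !abszM => {}E.
have : (`|denq (x + y)| %| `|denq x| * `|denq y|)%N.
  rewrite -(@Gauss_dvdr _ `|numq (x + y)|); last first.
    by rewrite coprime_sym coprime_num_den.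
  by rewrite E dvdn_mull.
move=> dv; apply/negP => /dvdn_trans/(_ dv).
by rewrite Euclid_dvdM ?prime_valP // (negPf px) (negPf py).
Qed.

Lemma padic_val_exp (k : int) : padic_val ((p : nat)%:R ^ k) = k.
Proof.
have valX (m : nat) : padic_val ((p : nat)%:R ^+ m) = m.
  elim: m => [|m IH]; first exact: padic_val1.
  rewrite exprS padic_valM ?expf_neq0 // IH.
  rewrite (_ : (p : nat)%:R = (Posz p)%:~R) // /padic_val numq_int denq_int.
  by rewrite !absz_nat logn_prime ?prime_valP // eqxx logn1 subr0 -PoszD.
case: k => m; first exact: valX.
by rewrite -[_ ^ _]/(_ ^- m.+1) padic_valV ?expf_neq0 // valX NegzE.
Qed.

Lemma padic_geD k x y : padic_ge k x -> padic_ge k y -> padic_ge k (x + y).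
Proof.
pose t : rat := (p : nat)%:R ^ k.
have t0 : t != 0 by rewrite expfz_neq0.
have tk : padic_ge k t by rewrite /padic_ge padic_val_exp lexx orbT.
have tVk : padic_ge (- k) t^-1.
  by rewrite /padic_ge padic_valV // padic_val_exp lexx orbT.
move=> xk yk; rewrite -[x + y](mulfVK t0) -[k]add0r.
apply: padic_geM => //; rewrite mulrDl.
by apply: padic_geD0; rewrite -(subrr k); apply: padic_geM.
Qed.

Lemma padic_geB k x y : padic_ge k x -> padic_ge k y -> padic_ge k (x - y).
Proof. by move=> ? ?; apply: padic_geD; rewrite ?padic_geN. Qed.

(* Q_p is the ring of p-adic Cauchy sequences of rationals modulo the ideal of
   sequences converging to 0. *)
Definition padic_cauchy : {pred nat -> rat} := fun u =>
  `[< forall k : int, exists N : nat, forall m n : nat,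
        (N <= m)%N -> (N <= n)%N -> padic_ge k (u m - u n) >].

Lemma padic_cauchyP u : reflect (forall k : int, exists N : nat, forall m : nat,
  (N <= m)%N -> padic_ge k (u m - u N)) (u \in padic_cauchy).
Proof.
apply: (iffP idP) => [/asboolP uC k|uC].
  by have [N NP] := uC k; exists N => m Nm; apply: NP.
apply/asboolP => k; have [N NP] := uC k; exists N => m n Nm Nn.
rewrite (_ : u m - u n = (u m - u N) - (u n - u N)); last by ring.
by rewrite padic_geB ?NP.
Qed.

Lemma padic_cauchy_bounded u : u \in padic_cauchy ->
  exists k N, forall m, (N <= m)%N -> padic_ge k (u m).
Proof.
move/padic_cauchyP/(_ 0) => [N NP]; exists (Order.min 0 (padic_val (u N))), N => m Nm.
rewrite -[u m](subrK (u N)); apply: padic_geD.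
  by apply: padic_ge_le (NP _ Nm); rewrite ge_min lexx.
by rewrite /padic_ge ge_min lexx !orbT.
Qed.

Lemma padic_cauchy_closed : subring_closed padic_cauchy.
Proof.
split=> [|u v /asboolP uC /asboolP vC|u v uC vC].
- by apply/asboolP => k; exists 0%N => m n _ _; rewrite subrr padic_ge0.
- apply/asboolP => k; have [M MP] := uC k; have [N NP] := vC k.
  exists (maxn M N) => m n; rewrite !geq_max => /andP[? ?] /andP[? ?].
  rewrite [X in padic_ge k X](_ : _ = (u m - u n) - (v m - v n)); last first.
    by rewrite /= !fctE; ring.
  by rewrite padic_geB ?MP ?NP.
have [a [A AP]] := padic_cauchy_bounded uC.
have [b [B BP]] := padic_cauchy_bounded vC.
move: uC vC => /asboolP uC /asboolP vC.
apply/asboolP => k; have [M MP] := uC (k - b); have [N NP] := vC (k - a).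
exists (maxn (maxn A B) (maxn M N)) => m n.
rewrite !geq_max => /andP[/andP[? ?] /andP[? ?]] /andP[/andP[? ?] /andP[? ?]].
rewrite [X in padic_ge k X](_ : _ =
    (u m - u n) * v m + u n * (v m - v n)); last by rewrite /= !fctE; ring.
apply: padic_geD.
  by rewrite -[k](subrK b); apply: padic_geM; rewrite ?MP ?BP.
by rewrite -[k](subrKC a); apply: padic_geM; rewrite ?AP ?NP.
Qed.
HB.instance Definition _ :=
  GRing.isSubringClosed.Build (nat -> rat) padic_cauchy padic_cauchy_closed.

Record padic_seq :=
  PadicSeq { padic_seq_val :> nat -> rat; _ : padic_seq_val \in padic_cauchy }.
HB.instance Definition _ := [isSub for padic_seq_val].
HB.instance Definition _ := [Choice of padic_seq by <:].
HB.instance Definition _ := [SubChoice_isSubComNzRing of padic_seq by <:].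

Definition padic_null : {pred padic_seq} := fun u =>
  `[< forall k : int, exists N : nat, forall n : nat,
        (N <= n)%N -> padic_ge k (u n) >].

Lemma padic_null_closed : idealr_closed padic_null.
Proof.
split.
- by apply/asboolP => k; exists 0%N => n _; rewrite padic_ge0.
- apply/negP => /asboolP/(_ 1)[N /(_ N (leqnn N))].
  by rewrite /padic_ge padic_val1.
move=> a u v /asboolP u0 /asboolP v0; apply/asboolP => k.
have [b [B BP]] := padic_cauchy_bounded (valP a).
have [M MP] := u0 (k - b); have [N NP] := v0 k.
exists (maxn B (maxn M N)) => n; rewrite !geq_max => /and3P[? ? ?].
apply: padic_geD; last exact: NP.
by rewrite -[k](subrKC b); apply: padic_geM; rewrite ?BP ?MP.
Qed.
HB.instance Definition _ :=
  isIdealr.Build padic_seq padic_null padic_null_closed.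

Definition Qp := {ideal_quot padic_null}.
HB.instance Definition _ := GRing.ComNzRing.on Qp.

Definition Qp_of_seq : padic_seq -> Qp := \pi_Qp%qT.
Lemma Qp_of_seq_zmod : zmod_morphism Qp_of_seq.
Proof. exact: (rmorphB \pi_Qp%qT). Qed.
Lemma Qp_of_seq_monoid : monoid_morphism Qp_of_seq.
Proof. by split; [exact: (rmorph1 \pi_Qp%qT)|exact: (rmorphM \pi_Qp%qT)]. Qed.
HB.instance Definition _ :=
  GRing.isZmodMorphism.Build padic_seq Qp Qp_of_seq Qp_of_seq_zmod.
HB.instance Definition _ :=
  GRing.isMonoidMorphism.Build padic_seq Qp Qp_of_seq Qp_of_seq_monoid.

Lemma Qp_of_seqK x : Qp_of_seq (repr x) = x. Proof. exact: reprK. Qed.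

Lemma Qp_of_seq_eq0 u : (Qp_of_seq u == 0) = (u \in padic_null).
Proof.
by rewrite -[0](rmorph0 Qp_of_seq) -[u in RHS]subr0 Quotient.idealrBE.
Qed.

Lemma padic_seq_inv (u : padic_seq) : u \notin padic_null ->
  exists v : padic_seq, u * v - 1 \in padic_null.
Proof.
move=> /asboolPn/existsNP[k uk]; move/forallNP: uk => uk.
have [N NP] := padic_cauchyP _ (valP u) k.
have big n : (N <= n)%N -> ~~ padic_ge k (u n).
  move=> Nn; apply/negP => un; apply: (uk N) => m Nm.
  rewrite (_ : u m = (u m - u N) - (u n - u N) + u n); last by ring.
  by rewrite padic_geD // padic_geB ?NP.
have big0 n : (N <= n)%N -> u n != 0.
  by move/big; rewrite /padic_ge negb_or => /andP[].
have bigV n : (N <= n)%N -> padic_ge (- k) (u n)^-1.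
  move=> Nn; rewrite /padic_ge padic_valV ?big0 // lerN2.
  by move/big: Nn; rewrite /padic_ge negb_or -ltNge => /andP[_ /ltW->]; rewrite orbT.
have vC : (fun n => (u n)^-1) \in padic_cauchy.
  apply/asboolP => l; have /asboolP/(_ (l + k + k)) [M MP] := valP u.
  exists (maxn M N) => m n; rewrite !geq_max => /andP[Mm Nm] /andP[Mn Nn].
  rewrite (_ : _ - _ = (u n - u m) * (u m)^-1 * (u n)^-1); last first.
    by field; rewrite !big0.
  rewrite (_ : l = l + k + k - k - k); last by ring.
  by apply: padic_geM; [apply: padic_geM; rewrite ?bigV ?MP|rewrite bigV].
exists (PadicSeq vC); apply/asboolP => l; exists N => n Nn.
rewrite [X in padic_ge _ X](_ : _ = u n * (u n)^-1 - 1) //.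
by rewrite mulfV ?big0 // subrr padic_ge0.
Qed.

Lemma Qp_inv_ex (x : Qp) : exists y, (x = 0 -> y = 0) /\ (x != 0 -> y * x = 1).
Proof.
have [->|x0] := eqVneq x 0; first by exists 0.
have : repr x \notin padic_null by rewrite -Qp_of_seq_eq0 Qp_of_seqK.
case/padic_seq_inv => v; rewrite -Qp_of_seq_eq0 rmorphB rmorphM rmorph1.
rewrite /= Qp_of_seqK subr_eq0 mulrC => /eqP xv.
by exists (Qp_of_seq v); split=> // xE; rewrite xE eqxx in x0.
Qed.

Definition Qp_inv (x : Qp) : Qp := projT1 (cid (Qp_inv_ex x)).
Lemma Qp_mulV x : x != 0 -> Qp_inv x * x = 1.
Proof. by rewrite /Qp_inv; case: cid => y []. Qed.
Lemma Qp_inv0 : Qp_inv 0 = 0.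
Proof. by rewrite /Qp_inv; case: cid => y [+ _] /=; apply. Qed.
HB.instance Definition _ := GRing.ComNzRing_isField.Build Qp Qp_mulV Qp_inv0.

Lemma padic_cst_subproof (r : rat) : (fun=> r) \in padic_cauchy.
Proof. by apply/asboolP => k; exists 0%N => m n _ _; rewrite subrr padic_ge0. Qed.

Definition Qp_of_rat (r : rat) : Qp :=
  Qp_of_seq (PadicSeq (padic_cst_subproof r)).

Lemma Qp_of_rat_zmod : zmod_morphism Qp_of_rat.
Proof. by move=> r s; rewrite -rmorphB; congr Qp_of_seq; apply: val_inj. Qed.
Lemma Qp_of_rat_monoid : monoid_morphism Qp_of_rat.
Proof.
split=> [|r s]; first by rewrite -[RHS](rmorph1 Qp_of_seq); congr Qp_of_seq; apply: val_inj.
by rewrite -rmorphM; congr Qp_of_seq; apply: val_inj.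
Qed.
HB.instance Definition _ :=
  GRing.isZmodMorphism.Build rat Qp Qp_of_rat Qp_of_rat_zmod.
HB.instance Definition _ :=
  GRing.isMonoidMorphism.Build rat Qp Qp_of_rat Qp_of_rat_monoid.

(* {x | v_p x >= k} = p^k Z_p *)
Definition Qp_ball (k : int) : set Qp :=
  [set x | exists2 u : padic_seq, x = Qp_of_seq u & forall n, padic_ge k (u n)].

Definition padic_int : set Qp := Qp_ball 0.

Lemma Qp_ball_le k l : l <= k -> Qp_ball k `<=` Qp_ball l.
Proof. by move=> lk x [u -> uk]; exists u => // n; apply: padic_ge_le (uk n). Qed.

Lemma Qp_ball0 k : Qp_ball k 0.
Proof. by exists 0 => [|n]; rewrite ?rmorph0 ?padic_ge0. Qed.

Lemma Qp_ballD k x y : Qp_ball k x -> Qp_ball k y -> Qp_ball k (x + y).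
Proof.
move=> [u -> uk] [v -> vk]; exists (u + v); first by rewrite rmorphD.
by move=> n; apply: padic_geD.
Qed.

Lemma Qp_ballN k x : Qp_ball k x -> Qp_ball k (- x).
Proof.
move=> [u -> uk]; exists (- u); first by rewrite rmorphN.
by move=> n; rewrite [X in padic_ge _ X](_ : _ = - u n) // padic_geN.
Qed.

Lemma Qp_ballM k l x y : Qp_ball k x -> Qp_ball l y -> Qp_ball (k + l) (x * y).
Proof.
move=> [u -> uk] [v -> vk]; exists (u * v); first by rewrite rmorphM.
by move=> n; apply: padic_geM.
Qed.

Lemma Qp_of_rat_ball k r : padic_ge k r -> Qp_ball k (Qp_of_rat r).
Proof. by move=> rk; exists (PadicSeq (padic_cst_subproof r)). Qed.

Definition Qp_open (U : set Qp) : Prop :=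
  forall x, U x -> exists k, forall y, Qp_ball k (y - x) -> U y.

Lemma Qp_openT : Qp_open setT. Proof. by move=> x _; exists 0. Qed.
Lemma Qp_openI (U V : set Qp) : Qp_open U -> Qp_open V -> Qp_open (U `&` V).
Proof.
move=> oU oV x [/oU[k kP] /oV[l lP]]; exists (Order.max k l) => y xy.
by split; [apply: kP|apply: lP]; apply: Qp_ball_le xy; rewrite le_max lexx ?orbT.
Qed.
Lemma Qp_open_bigU (I : Type) (f : I -> set Qp) :
  (forall i, Qp_open (f i)) -> Qp_open (\bigcup_i f i).
Proof.
by move=> of_ x [i _ /of_[k kP]]; exists k => y /kP fy; exists i.
Qed.
HB.instance Definition _ :=
  isOpenTopological.Build Qp Qp_openT Qp_openI Qp_open_bigU.

Lemma open_padic_int : open padic_int.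
Proof.
by move=> x xZ; exists 0 => y yx; rewrite -(subrK x y); apply: Qp_ballD.
Qed.

End Padic.

Variant place := v_infty | v_fin of prime_number.

Record place_off (S : set place) :=
  PlaceOff { place_prime :> prime_number; _ : ~ S (v_fin place_prime) }.

(* The ring of S-adeles, for a set S of places containing v_infty: there is
   no archimedean component. *)
Record adele (S : set place) := Adele {
  adele_val :> forall v : place_off S, Qp v;
  adele_valP : finite_set [set v | ~ padic_int (adele_val v)] }.

Section Adele.
Variable S : set place.
Implicit Types x y z : adele S.

HB.instance Definition _ := gen_eqMixin (adele S).
HB.instance Definition _ := gen_choiceMixin (adele S).

Lemma adele_eq x y : (forall v, x v = y v) -> x = y.
Proof.
case: x y => [x xP] [y yP] /= xy.
have {}xy : x = y by apply: functional_extensionality_dep.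
by subst y; congr Adele; apply: Prop_irrelevance.
Qed.

Definition adele0 : adele S.
Proof.
exists (fun=> 0); rewrite [X in finite_set X](_ : _ = set0) //.
by rewrite -subset0 => v /=; apply; apply: Qp_ball0.
Defined.

Definition adele1 : adele S.
Proof.
exists (fun=> 1); rewrite [X in finite_set X](_ : _ = set0) //.
rewrite -subset0 => v /=; apply.
by rewrite -(rmorph1 (Qp_of_rat v)); apply: Qp_of_rat_ball; rewrite /padic_ge padic_val1.
Defined.

Definition adele_opp x : adele S.
Proof.
exists (fun v => - x v); apply: sub_finite_set (adele_valP x) => v /= + xv.
by apply; apply: Qp_ballN.
Defined.

Definition adele_add x y : adele S.
Proof.
exists (fun v => x v + y v).
apply: (@sub_finite_set _ _ ([set v | ~ padic_int (x v)] `|` [set v | ~ padic_int (y v)])).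
  move=> v /= xyN; apply: contrapT => /not_orP[/contrapT xv /contrapT yv].
  by apply: xyN; apply: Qp_ballD.
by rewrite finite_setU; split; apply: adele_valP.
Defined.

Definition adele_mul x y : adele S.
Proof.
exists (fun v => x v * y v).
apply: (@sub_finite_set _ _ ([set v | ~ padic_int (x v)] `|` [set v | ~ padic_int (y v)])).
  move=> v /= xyN; apply: contrapT => /not_orP[/contrapT xv /contrapT yv].
  by apply: xyN; rewrite /padic_int -[0]addr0; apply: Qp_ballM.
by rewrite finite_setU; split; apply: adele_valP.
Defined.

Lemma adele_addA : associative adele_add.
Proof. by move=> x y z; apply: adele_eq => v /=; rewrite addrA. Qed.
Lemma adele_addC : commutative adele_add.
Proof. by move=> x y; apply: adele_eq => v /=; rewrite addrC. Qed.
Lemma adele_add0 : left_id adele0 adele_add.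
Proof. by move=> x; apply: adele_eq => v /=; rewrite add0r. Qed.
Lemma adele_addN : left_inverse adele0 adele_opp adele_add.
Proof. by move=> x; apply: adele_eq => v /=; rewrite addNr. Qed.
HB.instance Definition _ := GRing.isZmodule.Build (adele S)
  adele_addA adele_addC adele_add0 adele_addN.

Lemma adele_mulA : associative adele_mul.
Proof. by move=> x y z; apply: adele_eq => v /=; rewrite mulrA. Qed.
Lemma adele_mulC : commutative adele_mul.
Proof. by move=> x y; apply: adele_eq => v /=; rewrite mulrC. Qed.
Lemma adele_mul1 : left_id adele1 adele_mul.
Proof. by move=> x; apply: adele_eq => v /=; rewrite mul1r. Qed.
Lemma adele_mulDl : left_distributive adele_mul +%R.
Proof. by move=> x y z; apply: adele_eq => v /=; rewrite mulrDl. Qed.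
HB.instance Definition _ := GRing.Zmodule_isComPzRing.Build (adele S)
  adele_mulA adele_mulC adele_mul1 adele_mulDl.

(* The restricted product topology: the products of open sets U v, with
   U v = Z_p for almost all v, form a base. *)
Definition adele_box (U : forall v : place_off S, set (Qp v)) : set (adele S) :=
  [set x | forall v, U v (x v)].

Definition adele_open (W : set (adele S)) : Prop :=
  forall x, W x -> exists U : forall v : place_off S, set (Qp v),
    [/\ forall v, open (U v), finite_set [set v | U v <> @padic_int v],
        adele_box U x & adele_box U `<=` W].

Lemma adele_openT : adele_open setT.
Proof.
move=> x _.
exists (fun v => if pselect (padic_int (x v)) then @padic_int v else setT); split=> //.
- by move=> v; case: pselect => ?; [exact: open_padic_int|exact: openT].
- by apply: sub_finite_set (adele_valP x) => v /=; case: pselect.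
- by move=> v; case: pselect.
Qed.
Lemma adele_openI (W W' : set (adele S)) :
  adele_open W -> adele_open W' -> adele_open (W `&` W').
Proof.
move=> oW oW' x [Wx W'x].
have [U [oU fU Ux UW]] := oW _ Wx; have [U' [oU' fU' U'x U'W']] := oW' _ W'x.
exists (fun v => U v `&` U' v); split.
- by move=> v; apply: openI.
- apply: (@sub_finite_set _ _ ([set v | U v <> @padic_int v] `|` [set v | U' v <> @padic_int v])).
    move=> v /= UU'; apply: contrapT => /not_orP[/contrapT Uv /contrapT U'v].
    by apply: UU'; rewrite Uv U'v setIid.
  by rewrite finite_setU.
- by move=> v; split.
- by move=> y UU'y; split; [apply: UW|apply: U'W'] => v; have [] := UU'y v.
Qed.
Lemma adele_open_bigU (I : Type) (f : I -> set (adele S)) :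
  (forall i, adele_open (f i)) -> adele_open (\bigcup_i f i).
Proof.
move=> of_ x [i _ fx]; have [U [oU fU Ux UW]] := of_ _ _ fx; exists U; split=> //.
by move=> y /UW fy; exists i.
Qed.
HB.instance Definition _ :=
  isOpenTopological.Build (adele S) adele_openT adele_openI adele_open_bigU.

Definition adele_of_rat (r : rat) : adele S.
Proof.
exists (fun v => Qp_of_rat v r).
apply: (@sub_finite_set _ _ ((fun v : place_off S => v : nat) @^-1` `I_(`|denq r|.+1))).
  move=> v /= rN; rewrite ltnS; apply: contra_notT rN; rewrite -ltnNge => dv.
  apply: Qp_of_rat_ball; rewrite /padic_ge /padic_val.
  rewrite (_ : logn v `|denq r| = 0%N) ?subr0 ?orbT //.
  rewrite lognE; case: and3P => // -[_ d0 /(dvdn_leq d0)].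
  by rewrite leqNgt dv.
apply: finite_preimage => //.
move=> [v vS] [w wS] _ _ /= vw; have {}vw : v = w by apply: val_inj.
by subst w; congr PlaceOff; apply: Prop_irrelevance.
Defined.

Lemma adele_of_rat_zmod : zmod_morphism adele_of_rat.
Proof. by move=> r s; apply: adele_eq => v /=; rewrite rmorphB. Qed.
Lemma adele_of_rat_monoid : monoid_morphism adele_of_rat.
Proof. by split=> [|r s]; apply: adele_eq => v /=; rewrite (rmorph1, rmorphM). Qed.
HB.instance Definition _ :=
  GRing.isZmodMorphism.Build rat (adele S) adele_of_rat adele_of_rat_zmod.
HB.instance Definition _ :=
  GRing.isMonoidMorphism.Build rat (adele S) adele_of_rat adele_of_rat_monoid.

End Adele.

Section AdelicPoints.
Variables (n : nat) (q : {hermitian 'rV[L]_n for false & sigma}).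
Variable S : set place.

(* The S-adelic topology on G(A_S) is the coarsest one making all regular
   functions on G continuous; equivalently, it is induced by any closed
   embedding of G into an affine space. *)
Definition adelic_points := adjoint_group q (adele S).
HB.instance Definition _ := gen_eqMixin adelic_points.
HB.instance Definition _ := gen_choiceMixin adelic_points.
HB.instance Definition _ := Topological.copy adelic_points
  (initial_topology (fun x : adelic_points =>
     (x : adjoint_ring q -> adele S) : {ptws adjoint_ring q -> adele S})).

Definition rational_points : set adelic_points :=
  [set ((adele_of_rat S \o x) : adelic_points)
  | x in [set: adjoint_group q rat]].

(* [G(A_S) : closure of G(Q)] is the cardinality of this set. *)
Definition approximation_cosets : set (set adelic_points) :=
  left_cosets (closure rational_points).

Definition almost_strong_approximation : Prop :=
  finite_set approximation_cosets.

End AdelicPoints.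

Arguments rational_points {n} q S _.
Arguments approximation_cosets {n} q S _.
Arguments almost_strong_approximation {n} q S.

(* Main.v *)
From HB Require Import structures.
Require Import Defs.
From mathcomp Require Import all_boot all_order all_algebra.
From mathcomp Require Import all_classical topology.
From mathcomp Require Import ring zify qpoly.
From mathcomp Require Import perm cyclic finfield.
From mathcomp Require mpoly.
Import (canonicals, coercions) mpoly.

Set Implicit Arguments.
Unset Strict Implicit.
Unset Printing Implicit Defensive.
Import Order.TTheory GRing.Theory Num.Theory.
Local Open Scope classical_set_scope.
Local Open Scope ring_scope.

(** At a prime p = 1 mod 4 the field Q_p contains a square root of -1, so that
    SU_n(q) becomes SL_n and G becomes PGL_n over Q_p, and the determinant maps
    G(Q_p) to Q_p^* modulo n-th powers.  This invariant can be read off from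
    functions on G.  The centre consists of scalars c with c^n = 1 and
    c * conj c = 1 ([SU_center_scalar]), so a product of n matrix entries is a
    function on G with values in Q(i) ([monomial]); these products are the
    entries of the n-th tensor power of the standard representation, and are
    multiplicative in the point ([adjoint_mul_monomial]).  The point of PGL_n
    given by a matrix A takes them to the products of entries of A, divided by
    det A ([adjoint_point]).  In particular the n-th power of one entry becomes
    the inverse of det A, up to n-th powers.

    For a rational point, the value c of such an n-th power is an element of
    Q(i) whose norm is an n-th power in Q, as c * conj c is the n-th power of an
    invariant function ([monomial_norm]).  If the values of all monomials are
    integral at one place above each p = 1 mod 4, then the valuation of c is a
    multiple of n there: the determinant, equal to 1, is a sum of products of n
    entries, so one of these products is a unit ([monomial_val_dvd]).  As Z[i]
    is a unique factorisation domain whose units are n-th powers for odd n, c is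
    an n-th power in Q(i) ([gauss_rat_power], [rational_monomial_power]).

    Points in the closure of G(Q) are approximated by rational points, for
    finitely many functions integrally at all places and modulo a given place
    ([closure_rational_approx]).  So for a point of the closure whose monomials
    are integral everywhere, the n-th power of an entry is everywhere an n-th
    power modulo p.  Now let l be a prime factor of n.  For each place w = 1 mod
    4 l choose a unit u that is not an l-th power modulo w, and an adelic point
    x_w that is trivial outside of w and given by diag (1, u^-1, 1, ..) at w
    ([supported_point]).  For w <> w' the quotient of x_w' by x_w is integral
    everywhere, and takes the value u at w', so it is not in the closure of G(Q)
    ([coset_separation]).  As there are infinitely many such w
    ([prime_1mod4l_above]), there are infinitely many cosets. *)

(** * Arithmetic modulo a prime *)

Section PrimeField.
Variable p : nat.
Hypothesis p_pr : prime p.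

Lemma Fp_int_eq0 (m : int) : ((m%:~R : 'F_p) == 0) = (p %| m)%Z.
Proof.
have natE k : ((k%:R : 'F_p) == 0) = (p %| k)%N by rewrite -(dvdn_pcharf (pchar_Fp p_pr)).
case: m => m; first by rewrite dvdzE; exact: natE.
by rewrite {1}NegzE rmorphN oppr_eq0 dvdzE; exact: natE.
Qed.

Lemma Fp_expf_pred (x : 'F_p) : x != 0 -> x ^+ p.-1 = 1.
Proof.
move=> x0; apply: (mulfI x0); rewrite -exprS prednK ?prime_gt0 // mulr1.
by rewrite -{2}(expf_card x) card_Fp.
Qed.

Lemma Fp_int (x : 'F_p) : exists m : nat, x = m%:R.
Proof. by exists x; rewrite natr_Zp. Qed.

Lemma Fp_generator : exists x : 'F_p, p.-1.-primitive_root x.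
Proof.
have p1 : (0 < p.-1)%N by rewrite -subn1 subn_gt0 prime_gt1.
have /hasP[x _ xP] : has p.-1.-primitive_root (enum (predC1 (0 : 'F_p))).
  apply: has_prim_root => //; rewrite ?enum_uniq //.
    apply/allP => x; rewrite mem_enum inE => x0.
    by apply/unity_rootP; apply: Fp_expf_pred.
  by rewrite -cardE cardC1 card_Fp.
by exists x.
Qed.

Lemma sqrtN1_mod : (4 %| p.-1)%N -> exists g : int, (p %| g ^+ 2 + 1)%Z.
Proof.
have [x xP] := Fp_generator; case/dvdnP => k pk.
have k0 : (0 < k)%N by move: (prim_order_gt0 xP); rewrite pk; case: k {pk}.
have [m mE] := Fp_int (x ^+ k); exists m%:Z.
rewrite -Fp_int_eq0 rmorphD rmorphXn /= -[_%:~R]/(m%:R) -mE.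
have : ((x ^+ k) ^+ 2 - 1) * ((x ^+ k) ^+ 2 + 1) == 0.
  rewrite -subr_sqr expr1n -!exprM -mulnA -[(2 * 2)%N]/4%N -pk.
  by rewrite (prim_expr_order xP) subrr.
rewrite mulf_eq0 subr_eq0 -exprM -(prim_order_dvd xP) pk => /orP[|//].
by rewrite dvdn_pmul2l.
Qed.

(** A generator u of the unit group works: u = m^l would give
    u^((p-1)/l) = m^(p-1) = 1. *)
Lemma power_nonresidue (l : nat) : (1 < l)%N -> (l %| p.-1)%N ->
  exists2 u : int, ~~ (p %| u)%Z & forall m : int, ~~ (p %| m ^+ l - u)%Z.
Proof.
have [x xP] := Fp_generator => l1; case/dvdnP => k pk.
have k0 : (0 < k)%N by move: (prim_order_gt0 xP); rewrite pk; case: k {pk}.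
have [u uE] := Fp_int x; exists u%:Z => [|m]; rewrite -Fp_int_eq0.
  rewrite -[u%:~R]/(u%:R) -uE.
  apply/eqP => x0; have := prim_expr_order xP; rewrite x0 expr0n.
  by case: p.-1 (prim_order_gt0 xP) => //= ? _ /esym/eqP; rewrite oner_eq0.
rewrite rmorphB rmorphXn /= -[u%:~R]/(u%:R) -uE subr_eq0.
apply/negP => /eqP E.
have m0 : (m%:~R : 'F_p) != 0.
  apply/eqP => m0; have := prim_expr_order xP.
  rewrite -E m0 !expr0n gtn_eqF ?(ltnW l1) // expr0n.
  by case: p.-1 (prim_order_gt0 xP) => //= ? _ /esym/eqP; rewrite oner_eq0.
have : x ^+ k == 1 by rewrite -E -exprM mulnC -pk Fp_expf_pred.
rewrite -(prim_order_dvd xP) pk -{2}[k]muln1 dvdn_pmul2l // dvdn1.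
by rewrite gtn_eqF.
Qed.

(** Otherwise raise a^2 = - b^2 to the odd power (p-1)/2: the little theorem of
    Fermat gives 1 = -1. *)
Lemma prime_3mod4_dvd_sumsq (a b : int) : (p = 3 %[mod 4])%N ->
  (p %| a ^+ 2 + b ^+ 2)%Z -> (p %| a)%Z && (p %| b)%Z.
Proof.
move=> p3; rewrite -!Fp_int_eq0 rmorphD !rmorphXn /=.
move: (a%:~R : 'F_p) (b%:~R : 'F_p) => x y.
have [k pk] : exists k, p.-1 = (2 * k)%N /\ odd k.
  exists ((p %/ 4) * 2 + 1)%N; have := divn_eq p 4; rewrite p3; lia.
case: pk => pk ok.
rewrite addr_eq0 => /eqP xy; have [y0|y0] := eqVneq y 0.
  by move/eqP: xy; rewrite y0 expr0n oppr0 expf_eq0 /= => ->.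
have x0 : x != 0.
  by apply: contraNneq y0 => x0; move/eqP: xy; rewrite x0 expr0n eq_sym oppr_eq0 expf_eq0.
have := Fp_expf_pred x0; rewrite pk exprM xy exprNn -exprM -pk Fp_expf_pred //.
rewrite -signr_odd ok expr1 mulr1 => /eqP; rewrite eq_sym -subr_eq0 opprK.
rewrite -[1 + 1]/((2 : int)%:~R) Fp_int_eq0 dvdzE => /(dvdn_leq (isT : 0 < 2)%N) /= p2.
have : p = 2%N by have := prime_gt1 p_pr; lia.
by move=> p2E; exfalso; move: p3; rewrite p2E.
Qed.

(** Thue's lemma.  With s the integral part of the square root of p, there are
    more than p pairs of integers in [0, s], so two of them have the same value
    of x + g * y modulo p, and their difference is short. *)
Lemma thue (g : int) : exists x y : int,
  [/\ (x, y) != (0, 0), (p %| x + g * y)%Z & x ^+ 2 + y ^+ 2 < (2 * p)%N%:Z].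
Proof.
have [s s1 s2] : exists2 s, (s * s < p)%N & (p < s.+1 * s.+1)%N.
  have [s h1 h2] : exists2 s, (s * s <= p)%N & (p < s.+1 * s.+1)%N.
    elim: (p) => [|k [s h1 h2]]; first by exists 0%N.
    by case: (ltnP k.+1 (s.+1 * s.+1)%N) => h3; [exists s|exists s.+1] => //; nia.
  exists s; last exact: h2.
  rewrite ltn_neqAle h1 andbT; apply/eqP => sp; move: p_pr; rewrite -sp.
  apply/negP; apply/primePn; case: (ltnP 1 s) => [s_gt1|]; last by move: (s) => [|[]]; left.
  by right; exists s; rewrite ?dvdn_mulr // s_gt1 ltn_Pmull // ltnW.
pose f (t : 'I_s.+1 * 'I_s.+1) : 'F_p := (t.1%:Z + g * t.2%:Z)%:~R.
have /injectivePn[[x1 y1] [[x2 y2] neq /eqP]] : ~~ injectiveb f.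
  apply/negP => /injectiveP/leq_card.
  by rewrite card_prod (card_Fp p_pr) !card_ord leqNgt s2.
rewrite /f /= -subr_eq0 -rmorphB /= Fp_int_eq0 => fE.
exists (x1%:Z - x2%:Z), (y1%:Z - y2%:Z); split.
- apply: contra neq => /eqP[/eqP + /eqP]; rewrite !subr_eq0 !eqz_nat.
  by rewrite -pair_eqE /= -!val_eqE /= => -> ->.
- by move: fE; congr (_ %| `|_|)%N; ring.
have bd (a b : 'I_s.+1) : (a%:Z - b%:Z) ^+ 2 <= (s * s)%N%:Z.
  have := ltn_ord a; have := ltn_ord b; nia.
have := bd x1 x2; have := bd y1 y2; lia.
Qed.
End PrimeField.

(** Dirichlet's theorem for the class 1 modulo 4 l.  A prime p dividing the value
    at a of the cyclotomic polynomial (X^(2l) + 1) / (X^2 + 1) of order 4 l does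
    not divide a, and a has order 4 l modulo p unless p = l.  Taking a factorial
    for a excludes the small primes. *)
Lemma prime_1mod4l_above (l K : nat) : prime l -> odd l ->
  exists p, [/\ prime p, (K < p)%N & (4 * l %| p.-1)%N].
Proof.
move=> l_pr l_odd; have l1 := prime_gt1 l_pr.
pose a : nat := ((K + l).+2)`!.
pose Q : int := \sum_(i < l) (- (a%:Z) ^+ 2) ^+ i.
have a2 : (2 <= a)%N by rewrite dvdn_leq ?fact_gt0 // dvdn_fact.
have QE : ((a%:Z) ^+ 2 + 1) * Q = (a%:Z ^+ 2) ^+ l + 1.
  have := subrX1 (- (a%:Z ^+ 2)) l; rewrite -/Q exprNn -signr_odd l_odd expr1 mulN1r.
  by move=> E; lia.
have Q1 : (1 < `|Q|)%N.
  have : a%:Z ^+ 2 < (a%:Z ^+ 2) ^+ l by rewrite -[ltLHS]expr1 ltr_eXn2l //; nia.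
  by move: QE; set A := _ ^+ l; move=> QE AA; nia.
pose p := pdiv `|Q|; have p_pr : prime p by apply: pdiv_prime.
have pQ : (p %| Q)%Z by rewrite dvdzE pdiv_dvd.
pose x : 'F_p := a%:R.
pose y := - x ^+ 2.
have sy : \sum_(i < l) y ^+ i = 0.
  apply/eqP; move: pQ; rewrite -(Fp_int_eq0 p_pr) /Q rmorph_sum /=.
  by under eq_bigr do rewrite rmorphXn rmorphN rmorphXn /=.
have yl : y ^+ l = 1 by apply/subr0_eq; rewrite subrX1 sy mulr0.
have pK : (K + l < p)%N.
  rewrite ltnNge; apply/negP => pK.
  have : x == 0.
    by rewrite /x -(dvdn_pcharf (pchar_Fp p_pr)) dvdn_fact ?prime_gt0 // !leqW.
  move/eqP => x0; move: yl; rewrite /y x0 expr2 mulr0 oppr0 expr0n gtn_eqF ?prime_gt0 //=.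
have nat0 (k : nat) : (0 < k < p)%N -> k%:R != 0 :> 'F_p.
  case/andP=> k0 kp; rewrite -(dvdn_pcharf (pchar_Fp p_pr)); apply/negP => /(dvdn_leq k0).
  by rewrite leqNgt kp.
(* If y were 1, the sum would be l, which is nonzero modulo p > l. *)
have y1 : y != 1.
  apply/eqP => y1; move: sy; rewrite y1.
  under eq_bigr do rewrite expr1n.
  by rewrite sumr_const card_ord => /eqP; apply/negP/nat0; lia.
have x2l : x ^+ (2 * l) = -1.
  by rewrite exprM -[x ^+ 2]opprK -/y exprNn yl -signr_odd l_odd mulr1.
have x4l : x ^+ (4 * l) = 1.
  by rewrite -[4%N]/(2 * 2)%N -mulnA (mulnC 2 (2 * l)%N) exprM x2l sqrrN expr1n.
have [m xP m4l] : {m | m.-primitive_root x & (m %| 4 * l)%N}.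
  by apply: (prim_order_exists _ x4l); rewrite muln_gt0 (prime_gt0 l_pr).
have lm : (l %| m)%N.
  apply/negPn/negP; rewrite -prime_coprime // coprime_sym => ml.
  move: m4l; rewrite Gauss_dvdl // (prim_order_dvd xP) => /eqP x4.
  have y2 : y ^+ 2 = 1 by rewrite /y sqrrN -exprM.
  move/eqP: yl; rewrite -(odd_double_half l) l_odd -mul2n exprD exprM y2 expr1n mulr1.
  by rewrite expr1 (negPf y1).
case/dvdnP: lm => k mE.
have k4 : (k %| 4)%N by rewrite -(dvdn_pmul2r (prime_gt0 l_pr)) -mE.
have k2 : ~~ (k %| 2)%N.
  rewrite -(dvdn_pmul2r (prime_gt0 l_pr)) -mE (prim_order_dvd xP) x2l.
  rewrite eq_sym -subr_eq0 opprK -[1 + 1]/(2%:R); apply: nat0.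
  by have := odd_gt2 l_odd l1; lia.
have kE : k = 4%N.
  by have := dvdn_leq (isT : 0 < 4)%N k4; case: k k4 k2 {mE} => [|[|[|[|[|]]]]].
exists p; split=> //; first by apply: leq_ltn_trans pK; apply: leq_addr.
rewrite -kE -mE (prim_order_dvd xP) Fp_expf_pred //.
by apply/eqP => x0; move: yl; rewrite /y x0 expr2 mulr0 oppr0 expr0n gtn_eqF ?prime_gt0.
Qed.

(** The short vector of Thue's lemma has as norm a multiple of p between 0 and
    2 p. *)
Lemma prime_1mod4_sumsq (p : nat) (g : int) : prime p -> (p %| g ^+ 2 + 1)%Z ->
  exists a b : int, a ^+ 2 + b ^+ 2 = p /\ (p %| a + g * b)%Z.
Proof.
move=> p_pr pg; have [x [y [xy0 pxy xyp]]] := thue p_pr g.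
exists x, y; split=> //.
have : (p %| x ^+ 2 + y ^+ 2)%Z.
  rewrite (_ : _ + _ = (x + g * y) * (x - g * y) + (g ^+ 2 + 1) * y ^+ 2); last by ring.
  by rewrite rpredD ?dvdz_mulr.
case/dvdzP => k kE.
have p0 := prime_gt0 p_pr.
have k0 : 0 < x ^+ 2 + y ^+ 2.
  rewrite lt0r paddr_eq0 ?sqr_ge0 // !expf_eq0 /= addr_ge0 ?sqr_ge0 // andbT.
  by move: xy0; rewrite -pair_eqE.
by rewrite kE in xyp k0 *; have -> : k = 1 by [nia]; rewrite mul1r.
Qed.

(** * The rings R[i] *)

Definition gauss_norm (R : comNzRingType) (z : gauss R) : R := gre z ^+ 2 + gim z ^+ 2.

Lemma gauss_normM (R : comNzRingType) : {morph @gauss_norm R : x y / x * y}.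
Proof. by move=> [a b] [c d]; rewrite /gauss_norm /=; ring. Qed.

Lemma gauss_normX (R : comNzRingType) (z : gauss R) k : gauss_norm (z ^+ k) = gauss_norm z ^+ k.
Proof.
elim: k => [|k IH]; last by rewrite !exprS gauss_normM IH.
by rewrite !expr0 /gauss_norm /= expr1n expr0n addr0.
Qed.

Lemma gauss_norm_conj (R : comNzRingType) (z : gauss R) : gauss_norm (gauss_conj z) = gauss_norm z.
Proof. by rewrite /gauss_norm /= sqrrN. Qed.

Section GaussFunctor.
Variables (R R' : comNzRingType) (h : {rmorphism R -> R'}).

Lemma gauss_map_zmod : zmod_morphism (gauss_map h).
Proof. by move=> x y; congr Gauss; rewrite /= rmorphB. Qed.
HB.instance Definition _ :=
  GRing.isZmodMorphism.Build (gauss R) (gauss R') (gauss_map h) gauss_map_zmod.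
Lemma gauss_map_monoid : monoid_morphism (gauss_map h).
Proof.
by split=> [|x y]; congr Gauss; rewrite /= ?rmorph1 ?rmorph0 // (rmorphB, rmorphD) !rmorphM.
Qed.
HB.instance Definition _ :=
  GRing.isMonoidMorphism.Build (gauss R) (gauss R') (gauss_map h) gauss_map_monoid.

Lemma gauss_map_conj z : gauss_map h (gauss_conj z) = gauss_conj (gauss_map h z).
Proof. by congr Gauss; rewrite /= rmorphN. Qed.

End GaussFunctor.

Section GaussEval.
Variables (R : comNzRingType) (J : R).
Hypothesis JJ : J ^+ 2 = -1.

(** Evaluation at i = J.  The equation for J is an argument in order that the
    morphism structure can be inferred; the same device is used below for other
    maps that are morphisms only under a hypothesis. *)
Definition gauss_eval of J ^+ 2 = -1 := fun z : gauss R => gre z + J * gim z.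

Lemma gauss_eval_zmod : zmod_morphism (gauss_eval JJ).
Proof. by move=> x y; rewrite /gauss_eval /=; ring. Qed.
HB.instance Definition _ :=
  GRing.isZmodMorphism.Build (gauss R) R (gauss_eval JJ) gauss_eval_zmod.
Lemma gauss_eval_monoid : monoid_morphism (gauss_eval JJ).
Proof.
split=> [|x y]; rewrite /gauss_eval /=; first by rewrite mulr0 addr0.
transitivity (gre x * gre y + J ^+ 2 * (gim x * gim y)
  + J * (gre x * gim y + gim x * gre y)); last by ring.
by rewrite JJ; ring.
Qed.
HB.instance Definition _ :=
  GRing.isMonoidMorphism.Build (gauss R) R (gauss_eval JJ) gauss_eval_monoid.

Lemma gauss_eval_norm z : gauss_eval JJ z * gauss_eval JJ (gauss_conj z) = gauss_norm z.
Proof.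
rewrite /gauss_eval /gauss_norm /=.
transitivity (gre z ^+ 2 - J ^+ 2 * gim z ^+ 2); first by ring.
by rewrite JJ; ring.
Qed.

End GaussEval.

Section GaussConst.
Variable R : comNzRingType.
Definition gauss_const (a : R) : gauss R := Gauss a 0.
Lemma gauss_const_zmod : zmod_morphism gauss_const.
Proof. by move=> a b; congr Gauss; rewrite /= subr0. Qed.
HB.instance Definition _ := GRing.isZmodMorphism.Build R (gauss R) gauss_const gauss_const_zmod.
Lemma gauss_const_monoid : monoid_morphism gauss_const.
Proof. by split=> // a b; congr Gauss; rewrite /= !(mulr0, mul0r) ?subr0 ?addr0. Qed.
HB.instance Definition _ :=
  GRing.isMonoidMorphism.Build R (gauss R) gauss_const gauss_const_monoid.
Lemma gauss_intE (m : int) : (m%:~R : gauss R) = Gauss m%:~R 0.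
Proof. by rewrite -(rmorph_int gauss_const). Qed.

Lemma gauss_conjK : involutive (@gauss_conj R).
Proof. by case=> a b; congr Gauss; rewrite /= opprK. Qed.
End GaussConst.

Definition gint_eval (R : comNzRingType) (J : R) (JJ : J ^+ 2 = -1) : gauss int -> R :=
  gauss_eval JJ \o gauss_map intr.
HB.instance Definition _ (R : comNzRingType) (J : R) (JJ : J ^+ 2 = -1) :=
  GRing.RMorphism.on (gint_eval JJ).

Lemma gint_eval_norm (R : comNzRingType) (J : R) (JJ : J ^+ 2 = -1) z :
  gint_eval JJ z * gint_eval JJ (gauss_conj z) = (gauss_norm z)%:~R.
Proof. by rewrite /gint_eval /= gauss_map_conj gauss_eval_norm rmorphD !rmorphXn. Qed.

(** * Divisibility of Gaussian integers *)

Local Notation gint := (gauss int).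

Lemma gint_intE (m : int) : (m%:~R : gint) = Gauss m 0.
Proof. by rewrite gauss_intE intz. Qed.

Definition gdvd (d z : gint) := exists w, z = d * w.

Lemma gdvd_two (z : gint) : (2 %| gauss_norm z)%Z -> gdvd (Gauss 1 1) z.
Proof.
case: z => x y; rewrite /gauss_norm /= => h.
exists (Gauss ((x + y) %/ 2)%Z ((y - x) %/ 2)%Z).
have h1 : (2 %| x + y)%Z.
  have : (2 %| (x + y) ^+ 2)%Z.
    by rewrite sqrrD addrAC -mulr_natl rpredD ?dvdz_mulr.
  by rewrite !dvdzE abszX Euclid_dvdX // andbT.
have h2 : (2 %| y - x)%Z by lia.
by congr Gauss => /=; lia.
Qed.

Lemma gdvd_two_exp k (z : gint) : ((2 ^+ k : int) %| gauss_norm z)%Z -> gdvd (Gauss 1 1 ^+ k) z.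
Proof.
elim: k z => [|k IH] z; first by exists z; rewrite mul1r.
rewrite exprS => h; have [|w zE] := @gdvd_two z; first by apply: dvdz_trans h; apply: dvdz_mulr.
move: h; rewrite zE gauss_normM (_ : gauss_norm (Gauss 1 1) = 2) // dvdz_mul2l //= => /IH[w' ->].
by exists w'; rewrite exprS mulrA.
Qed.

Lemma gdvd_int (p : int) (z : gint) : (p %| gre z)%Z -> (p %| gim z)%Z -> gdvd p%:~R z.
Proof.
case: z => x y /= /dvdzP[a ->] /dvdzP[b ->]; exists (Gauss a b).
by rewrite gint_intE; congr Gauss => /=; ring.
Qed.

Section Split.
Variables (p : nat) (g a b : int).
Hypothesis p_pr : prime p.
Hypothesis pg : (p %| g ^+ 2 + 1)%Z.
Hypothesis ab : a ^+ 2 + b ^+ 2 = p.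
Hypothesis pab : (p %| a + g * b)%Z.

(** a + b i is the prime above p at which i reduces to g.  If z reduces to 0
    there, then p divides z * (a - b i), as at the other prime above p it is
    a - b i that reduces to 0. *)
Lemma gdvd_split (z : gint) : (p %| gre z + g * gim z)%Z -> gdvd (Gauss a b) z.
Proof.
case: z => x y /= pz.
have p0 : p%:Z != 0 by have := prime_gt0 p_pr; lia.
have /dvdzP[s sE] : (p %| x * a + y * b)%Z.
  rewrite (_ : _ + _ = (x + g * y) * a - y * (g * (a + g * b) - (g ^+ 2 + 1) * b)); last by ring.
  apply: rpredB; first exact: dvdz_mulr.
  by apply: dvdz_mull; apply: rpredB; [apply: dvdz_mull|apply: dvdz_mulr].
have /dvdzP[t tE] : (p %| y * a - x * b)%Z.
  rewrite (_ : _ - _ = y * (a + g * b) - (x + g * y) * b); last by ring.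
  by apply: rpredB; [apply: dvdz_mull|apply: dvdz_mulr].
exists (Gauss s t); congr Gauss => /=; apply: (mulIf p0).
  rewrite mulrBl -!mulrA -sE -tE -ab; ring.
rewrite mulrDl -!mulrA -sE -tE -ab; ring.
Qed.
End Split.

(** * Valuations on p-adic fields *)

Section PadicBalls.
Variable p : prime_number.
Notation Qp := (Qp p).
Implicit Types (x y : Qp) (k l : int) (r s : rat).

Let p_pr : prime p := prime_valP p.

Lemma padic_nullP (u : padic_seq p) k : Qp_of_seq u = 0 ->
  exists N, forall n, (N <= n)%N -> padic_ge p k (u n).
Proof. by move/eqP; rewrite Qp_of_seq_eq0 => /asboolP/(_ k). Qed.

(** The definition of [Qp_ball] constrains all the terms of a representing
    sequence; finitely many of them may be overwritten. *)
Lemma Qp_of_seq_eventually (u : padic_seq p) k N :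
  (forall n, (N <= n)%N -> padic_ge p k (u n)) -> Qp_ball k (Qp_of_seq u).
Proof.
move=> uk; have /asboolP uC := valP u.
have vC : (fun n => u (maxn N n)) \in padic_cauchy p.
  apply/asboolP => l; have [M MP] := uC l; exists M => m n Mm Mn.
  by apply: MP; rewrite leq_max ?Mm ?Mn orbT.
exists (PadicSeq vC) => [|n]; last by apply: uk; rewrite leq_maxl.
apply/subr0_eq/eqP; rewrite -rmorphB Qp_of_seq_eq0; apply/asboolP => l.
exists N => n Nn; rewrite [X in padic_ge _ _ X](_ : _ = u n - u (maxn N n)) //.
by rewrite (maxn_idPr Nn) subrr padic_ge0.
Qed.

Lemma Qp_of_rat_ballE k r : Qp_ball k (Qp_of_rat p r) <-> padic_ge p k r.
Proof.
split=> [[u uE uk]|]; last exact: Qp_of_rat_ball.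
have [N /(_ N (leqnn N)) h] : exists N, forall n, (N <= n)%N -> padic_ge p k (r - u n).
  apply: (@padic_nullP (PadicSeq (padic_cst_subproof p r) - u)).
  by rewrite rmorphB /= -uE subrr.
by rewrite -(subrK (u N) r) padic_geD.
Qed.

Lemma padic_val_int (m : int) : m != 0 -> padic_val p m%:~R = logn p `|m|.
Proof. by move=> m0; rewrite /padic_val numq_int denq_int logn1 subr0. Qed.

Lemma padic_ge_int (m : int) (e : nat) : padic_ge p e%:Z m%:~R = ((p ^ e)%N%:Z %| m)%Z.
Proof.
have [->|m0] := eqVneq m 0; first by rewrite padic_ge0 dvdz0.
rewrite /padic_ge intr_eq0 (negPf m0) padic_val_int //= lez_nat dvdzE /=.
by rewrite pfactor_dvdn // absz_gt0.
Qed.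

(** The valuation as a relation.  Bounding the inverse as well makes it
    multiplicative without further argument. *)
Definition has_val x k := [/\ x != 0, Qp_ball k x & Qp_ball (- k) x^-1].

Lemma has_val_ge x k l : has_val x k -> Qp_ball l x <-> l <= k.
Proof.
case=> x0 xk xVk; split=> [xl|lk]; last exact: Qp_ball_le xk.
have := Qp_ballM xl xVk; rewrite mulfV // -(rmorph1 (Qp_of_rat p)) => /Qp_of_rat_ballE.
by rewrite /padic_ge oner_eq0 padic_val1 subr_le0.
Qed.

Lemma has_val_uniq x k l : has_val x k -> has_val x l -> k = l.
Proof.
move=> xk xl; apply/le_anti/andP; split.
  by apply/(has_val_ge _ xl); case: xk.
by apply/(has_val_ge _ xk); case: xl.
Qed.

Lemma has_valM x y k l : has_val x k -> has_val y l -> has_val (x * y) (k + l).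
Proof.
move=> [x0 xk xVk] [y0 yl yVl]; split; first by rewrite mulf_neq0.
  exact: Qp_ballM.
by rewrite invfM opprD; apply: Qp_ballM.
Qed.

Lemma has_valV x k : has_val x k -> has_val x^-1 (- k).
Proof. by case=> x0 xk xVk; split; rewrite ?invr_eq0 ?opprK ?invrK. Qed.

Lemma has_val1 : has_val 1 0.
Proof.
by rewrite /has_val invr1 oppr0 oner_neq0 -(rmorph1 (Qp_of_rat p)); split=> //;
  apply/Qp_of_rat_ballE; rewrite /padic_ge padic_val1.
Qed.

Lemma has_valX x k m : has_val x k -> has_val (x ^+ m) (k *+ m).
Proof.
move=> xk; elim: m => [|m IH]; first by rewrite expr0 mulr0n; exact: has_val1.
by rewrite exprS mulrS; apply: has_valM.
Qed.

Lemma has_val_rat r : r != 0 -> has_val (Qp_of_rat p r) (padic_val p r).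
Proof.
move=> r0; split; first by rewrite fmorph_eq0.
  by apply/Qp_of_rat_ballE; rewrite /padic_ge lexx orbT.
rewrite -fmorphV; apply/Qp_of_rat_ballE.
by rewrite /padic_ge padic_valV // lexx orbT.
Qed.

Lemma padic_val_near k r s :
  ~~ padic_ge p k r -> padic_ge p k (s - r) -> s != 0 /\ padic_val p s = padic_val p r.
Proof.
move=> rk srk.
have sk : ~~ padic_ge p k s.
  by apply: contra rk => sk; rewrite -(subKr s r) padic_geB.
have := sk; have := rk; rewrite /padic_ge !negb_or -!ltNge => /andP[r0 rk'] /andP[s0 sk'].
split=> //; apply/le_anti/andP; split; rewrite leNgt; apply/negP => lt.
- have : padic_ge p (padic_val p r + 1) (s - (s - r)).
    apply: padic_geB; first by rewrite /padic_ge lezD1 lt orbT.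
    by apply: padic_ge_le srk; rewrite lezD1.
  by rewrite subKr /padic_ge (negPf r0) /=; lia.
- have : padic_ge p (padic_val p s + 1) ((s - r) + r).
    apply: padic_geD; last by rewrite /padic_ge lezD1 lt orbT.
    by apply: padic_ge_le srk; rewrite lezD1.
  by rewrite subrK /padic_ge (negPf s0) /=; lia.
Qed.

(** If u and v are Cauchy sequences for x and its inverse, then u * v tends to 1,
    and the valuation of u is eventually constant; so that of v is eventually
    its opposite. *)
Lemma has_val_exists x : x != 0 -> exists k, has_val x k.
Proof.
move=> x0; pose u := repr x; pose v := repr x^-1.
have uE : x = Qp_of_seq u by rewrite Qp_of_seqK.
have vE : x^-1 = Qp_of_seq v by rewrite Qp_of_seqK.
have [M MP] : exists N, forall n, (N <= n)%N -> padic_ge p 1 (u n * v n - 1).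
  apply: (@padic_nullP (u * v - 1)).
  by rewrite rmorphB rmorphM rmorph1 /= -uE -vE mulfV // subrr.
have : u \notin @padic_null p by rewrite -Qp_of_seq_eq0 -uE.
move=> /asboolPn/existsNP[k uk]; move/forallNP: uk => uk.
have /asboolP/(_ k)[N NP] := valP u.
have [m Mm um] : exists2 m, (maxn N M <= m)%N & ~~ padic_ge p k (u m).
  move: (uk (maxn N M)) => /existsNP[m /not_implyP[Nm um]]; exists m => //.
  exact/negP.
move: Mm; rewrite geq_max => /andP[Nm Mm].
exists (padic_val p (u m)); split=> //.
  rewrite uE; apply: (@Qp_of_seq_eventually _ _ m) => n mn.
  have [|_ unE] := @padic_val_near k (u m) (u n) um; first by rewrite NP // (leq_trans Nm).
  by rewrite /padic_ge unE lexx orbT.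
rewrite vE; apply: (@Qp_of_seq_eventually _ _ m) => n mn.
have [|un0 unE] := @padic_val_near k (u m) (u n) um; first by rewrite NP // (leq_trans Nm).
have [||uv0] := @padic_val_near 1 1 (u n * v n).
- by rewrite /padic_ge oner_eq0 padic_val1.
- by rewrite MP // (leq_trans Mm).
rewrite padic_val1 padic_valM //; last by move: uv0; rewrite mulf_eq0 negb_or => /andP[].
rewrite unE /padic_ge; case: eqP => //= _; lia.
Qed.

(** Modulo p, a p-integral fraction equals its numerator times an inverse of its
    denominator. *)
Lemma padic_int_residue x : padic_int x -> exists m : int, Qp_ball 1 (x - m%:~R).
Proof.
case=> u uE u0; have /padic_cauchyP/(_ 1)[N NP] := valP u.
have h1 : Qp_ball 1 (x - Qp_of_rat p (u N)).
  rewrite uE -[Qp_of_rat p _]/(Qp_of_seq _) -rmorphB.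
  exact: (@Qp_of_seq_eventually _ _ N).
set r := u N in h1 *.
have rden : ~~ (p %| `|denq r|)%N.
  apply/negP => pd; have := u0 N; rewrite -/r /padic_ge.
  have [r0|r0] := eqVneq r 0; first by move: pd; rewrite r0 dvdn1 gtn_eqF ?prime_gt1.
  rewrite /padic_val subr_ge0 lez_nat /=; have /eqP := coprime_num_den r.
  move=> c h; have : (0 < logn p `|numq r|)%N.
    by apply: leq_trans h; rewrite logn_gt0 mem_primes p_pr pd absz_gt0 denq_neq0.
  rewrite logn_gt0 mem_primes => /and3P[_ _ pn].
  by have := dvdn_gcd p `|numq r| `|denq r|; rewrite c pn pd Euclid_dvd1.
have [b bE] : exists b : int, (p %| b * denq r - 1)%Z.
  have : coprimez p (denq r) by rewrite coprimezE /= prime_coprime.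
  case/coprimezP => -[w b] /= E; exists b; apply/dvdzP; exists (- w).
  by rewrite -E; ring.
exists (numq r * b).
rewrite (_ : _ - _ = (x - Qp_of_rat p r) + Qp_of_rat p (r - (numq r * b)%:~R)); last first.
  by rewrite rmorphB rmorph_int addrA subrK.
apply: Qp_ballD => //; apply: Qp_of_rat_ball.
rewrite (_ : r - _ = - (r * (b * denq r - 1)%:~R)); last first.
  by rewrite !rmorphM rmorphB /= rmorphM /= numqE; ring.
rewrite padic_geN -[1]add0r; apply: padic_geM; first exact: u0.
by rewrite -[1]/(1%N%:Z) padic_ge_int expn1.
Qed.

Lemma Qp_ball_int1 (m : int) : Qp_ball 1 (m%:~R : Qp) <-> (p %| m)%Z.
Proof.
by rewrite -(rmorph_int (Qp_of_rat p)) Qp_of_rat_ballE -[1]/(1%N%:Z) padic_ge_int expn1.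
Qed.

Lemma padic_int_int (m : int) : padic_int (m%:~R : Qp).
Proof.
rewrite /padic_int -(rmorph_int (Qp_of_rat p)); apply/Qp_of_rat_ballE.
by rewrite -[0]/(0%N%:Z) padic_ge_int dvd1z.
Qed.

Lemma padic_intM x y : padic_int x -> padic_int y -> padic_int (x * y).
Proof. exact: Qp_ballM. Qed.

Lemma padic_intX x m : padic_int x -> padic_int (x ^+ m).
Proof.
move=> x0; elim: m => [|m IH]; first exact: (padic_int_int 1).
by rewrite exprS; apply: padic_intM.
Qed.

Lemma padic_int_prod (X : finType) (P : pred X) (F : X -> Qp) :
  (forall i, P i -> padic_int (F i)) -> padic_int (\prod_(i | P i) F i).
Proof.
move=> FP; elim/big_ind: _ => //; first exact: (padic_int_int 1).
exact: padic_intM.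
Qed.

Lemma Qp_ball_mulr k x y : Qp_ball k x -> padic_int y -> Qp_ball k (x * y).
Proof. by rewrite -{2}[k]addr0; apply: Qp_ballM. Qed.

Lemma has_val0_int (u : int) : ~~ (p %| u)%Z -> has_val (u%:~R : Qp) 0.
Proof.
move=> pu; have u0 : u%:~R != 0 :> Qp.
  by apply: contra pu => /eqP u0; apply/(Qp_ball_int1 u); rewrite u0; apply: Qp_ball0.
have [k kP] := has_val_exists u0.
have k0 : 0 <= k by apply/(has_val_ge _ kP); apply: padic_int_int.
have k1 : ~~ (1 <= k) by apply: contra pu => k1; apply/(Qp_ball_int1 u)/(has_val_ge _ kP).
by have <- : k = 0 by lia.
Qed.

End PadicBalls.

(** Newton's iteration for X^2 + 1 from g: with t = - (a^2 + 1) / (2 a), one has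
    (a + t)^2 + 1 = t^2, so the precision grows at each step. *)
Lemma sqrtN1_padic (p : prime_number) (g : int) : odd p -> (p %| g ^+ 2 + 1)%Z ->
  exists2 J : Qp p, J ^+ 2 = -1 & padic_int J.
Proof.
move=> p_odd pg; have p_pr := prime_valP p.
pose f (a : rat) := a - (a ^+ 2 + 1) / (2 * a).
pose u k := iter k f g%:~R.
have v2 : padic_val p 2 = 0.
  rewrite (_ : 2 = 2%:Z%:~R) // padic_val_int //= lognE p_pr /=.
  by rewrite dvdn_prime2 //; case: eqP => // E; rewrite E in p_odd.
have step (k : nat) (a : rat) : padic_ge p 0 a -> padic_ge p k.+1 (a ^+ 2 + 1) ->
  [/\ padic_ge p k.+1 (f a - a), padic_ge p 0 (f a) & padic_ge p k.+2 (f a ^+ 2 + 1)].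
  move=> a0 ak.
  have [a2 va2] : a ^+ 2 != 0 /\ padic_val p (a ^+ 2) = 0.
    have [||? ->] := @padic_val_near p 1 (-1) (a ^+ 2).
    - by rewrite padic_geN /padic_ge oner_eq0 padic_val1.
    - by rewrite opprK; apply: padic_ge_le ak.
    by split=> //; rewrite /padic_val numqN denqN abszN -/(padic_val p 1) padic_val1.
  have an0 : a != 0 by apply: contraNneq a2 => ->; rewrite expr0n.
  have va : padic_val p a = 0.
    by move: va2; rewrite expr2 padic_valM //; lia.
  have tk : padic_ge p k.+1 (f a - a).
    rewrite /f addrC addKr padic_geN -[X in padic_ge p X]addr0; apply: padic_geM => //.
    have a2n : 2 * a != 0 by rewrite mulf_neq0.
    by rewrite /padic_ge padic_valV // padic_valM // v2 va /= orbT.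
  split=> //; first by rewrite -(subrK a (f a)); apply: padic_geD => //; apply: padic_ge_le tk.
  rewrite (_ : f a ^+ 2 + 1 = (f a - a) * (f a - a)); last by rewrite /f; field.
  by apply: padic_ge_le (padic_geM tk tk); lia.
have uP k : padic_ge p 0 (u k) /\ padic_ge p k.+1 (u k ^+ 2 + 1).
  elim: k => [|k [u0 uk]]; last by have [] := step k _ u0 uk.
  split; first by rewrite (padic_ge_int p g 0) dvd1z.
  by rewrite (_ : u 0%N ^+ 2 + 1 = (g ^+ 2 + 1)%:~R) ?(padic_ge_int p _ 1) ?expn1 //
     rmorphD rmorphXn.
have uC : u \in padic_cauchy p.
  apply/padic_cauchyP => k; exists `|k|%N => m km.
  suff h (d : nat) : padic_ge p k (u (`|k| + d)%N - u `|k|%N) by rewrite -(subnKC km).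
  elim: d => [|d IH]; first by rewrite addn0 subrr padic_ge0.
  rewrite addnS -[u (_.+1)](subrK (u (`|k| + d)%N)) -addrA; apply: padic_geD => //.
  have [u0 uk] := uP (`|k| + d)%N; have [h _ _] := step _ _ u0 uk.
  by apply: padic_ge_le h; lia.
exists (Qp_of_seq (PadicSeq uC)); last first.
  by exists (PadicSeq uC) => // n; have [] := uP n.
apply/eqP; rewrite -addr_eq0 -rmorphXn -(rmorph1 (@Qp_of_seq p)) -rmorphD /= Qp_of_seq_eq0.
apply/asboolP => k; exists `|k|%N => n kn; have [_ h] := uP n.
by apply: padic_ge_le h; lia.
Qed.

(** * Powers in Q(i) *)

Section PadicSplit.
Variables (p : prime_number) (J : Qp p).
Hypotheses (JJ : J ^+ 2 = -1) (J0 : padic_int J).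
Notation phi := (gint_eval JJ).

Let p_pr : prime p := prime_valP p.

Lemma gint_eval_int z : padic_int (phi z).
Proof.
apply: Qp_ballD; first exact: padic_int_int.
by apply: padic_intM => //; apply: padic_int_int.
Qed.

Lemma gint_eval_neq0 z : gauss_norm z != 0 -> phi z != 0.
Proof.
apply: contraNneq => z0; have := gint_eval_norm JJ z; rewrite z0 mul0r => /esym/eqP.
by rewrite -(rmorph_int (Qp_of_rat p)) fmorph_eq0 intr_eq0.
Qed.

(** pi is the prime above p at which i reduces to the residue of J.  The values of
    pi and of its conjugate are integral with product p, and the first one is
    0 modulo p, so its valuation is 1; dividing z by pi then lowers the valuation
    of the value of z by 1. *)
Lemma split_prime : exists2 pi : gint, gauss_norm pi = p &
  forall (e : nat) z, Qp_ball e%:Z (phi z) -> gdvd (pi ^+ e) z.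
Proof.
have [g gJ] := padic_int_residue J0.
have pg : (p %| g ^+ 2 + 1)%Z.
  apply/Qp_ball_int1; rewrite rmorphD rmorphXn rmorph1 /=.
  rewrite (_ : _ + _ = - ((J - g%:~R) * (J + g%:~R))); last first.
    by rewrite -subr_sqr JJ opprB opprK addrC.
  apply: Qp_ballN; apply: Qp_ball_mulr => //.
  by apply: Qp_ballD => //; apply: padic_int_int.
have phiE z : Qp_ball 1 (phi z) <-> (p %| gre z + g * gim z)%Z.
  rewrite -Qp_ball_int1 rmorphD rmorphM /=.
  have E : phi z = ((gre z)%:~R + g%:~R * (gim z)%:~R) + (J - g%:~R) * (gim z)%:~R.
    by rewrite /gint_eval /gauss_eval /=; ring.
  have h : Qp_ball 1 ((J - g%:~R) * (gim z)%:~R).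
    by apply: Qp_ball_mulr => //; apply: padic_int_int.
  split=> hz; last by rewrite E; apply: Qp_ballD.
  rewrite (_ : _ + _ = phi z - (J - g%:~R) * (gim z)%:~R); last by rewrite E addrK.
  by apply: Qp_ballD => //; apply: Qp_ballN.
have [a [b [ab pab]]] := prime_1mod4_sumsq p_pr pg.
exists (Gauss a b) => // e; elim: e => [|e IH] z; first by exists z; rewrite mul1r.
move=> ze; have z1 : Qp_ball 1 (phi z) by apply: Qp_ball_le ze.
have [w zE] := gdvd_split p_pr pg ab pab (iffLR (phiE z) z1).
have np : gauss_norm (Gauss a b) != 0 by rewrite /gauss_norm /= ab; have := prime_gt0 p_pr; lia.
have [k kP] := has_val_exists (gint_eval_neq0 np).
have [l lP] : exists l, has_val (phi (gauss_conj (Gauss a b))) l.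
  by apply/has_val_exists/gint_eval_neq0; rewrite gauss_norm_conj.
have k1 : 1 <= k by apply/(has_val_ge _ kP)/phiE.
have l0 : 0 <= l by apply/(has_val_ge _ lP)/gint_eval_int.
have kl : k + l = 1.
  have := has_valM kP lP; rewrite gint_eval_norm /gauss_norm /= ab => h.
  apply: (has_val_uniq h); rewrite -(rmorph_int (Qp_of_rat p)).
  have := @has_val_rat p p%:~R; rewrite intr_eq0 padic_val_int; last by have := prime_gt0 p_pr; lia.
  by rewrite /= logn_prime // eqxx; apply; have := prime_gt0 p_pr; lia.
have [|w' wE] := IH w; last by exists w'; rewrite zE wE exprS mulrA.
move: ze; rewrite zE rmorphM /= => ze.
have -> : phi w = (phi (Gauss a b))^-1 * (phi (Gauss a b) * phi w).
  by rewrite mulKf //; case: kP.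
rewrite (_ : e%:Z = - k + e.+1%:Z); last by lia.
by apply: Qp_ballM => //; case: kP.
Qed.
End PadicSplit.

(** This only sees one of the two places above each p = 1 mod 4.  The other one,
    and the places above the remaining primes, are controlled by the norm. *)
Definition power_locally (n : nat) (z : gint) :=
  forall p : prime_number, (p = 1 %[mod 4])%N ->
  exists (J : Qp p) (JJ : J ^+ 2 = -1) (k : int),
    padic_int J /\ has_val (gint_eval JJ z) (k *+ n).

(** p remains prime in Z[i], so it divides z as soon as it divides the norm of z,
    which then contains p twice. *)
Lemma gdvd_inert (p : nat) (e : nat) (z : gint) : prime p -> (p = 3 %[mod 4])%N ->
  ((p ^ e.*2.-1)%N%:Z %| gauss_norm z)%Z -> gdvd ((p%:Z%:~R) ^+ e) z.
Proof.
move=> p_pr p3; elim: e z => [|e IH] z; first by exists z; rewrite mul1r.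
rewrite doubleS /= => h.
have pz : (p %| gauss_norm z)%Z by apply: dvdz_trans h; rewrite expnS PoszM dvdz_mulr.
have /andP[p1 p2] := prime_3mod4_dvd_sumsq p_pr p3 pz.
have [w zE] := gdvd_int p1 p2.
have [|w' wE] := IH w; last by exists w'; rewrite zE wE exprS mulrA.
move: h; rewrite zE gauss_normM gint_intE /gauss_norm /= expr0n addr0.
case: e {IH} => [|e]; first by rewrite dvd1z.
rewrite -[e.+1.*2]/(e.*2.+2) /= 2!expnS mulnA PoszM.
by rewrite (_ : (p * p)%N%:Z = p%:Z ^+ 2) // dvdz_mul2l //; have := prime_gt0 p_pr; nia.
Qed.

Lemma gdvd_conj (d z : gint) : gdvd (gauss_conj d) z -> gdvd d (gauss_conj z).
Proof.
by move=> [w ->]; exists (gauss_conj w); rewrite rmorphM /= gauss_conjK.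
Qed.

(** Take pi above a prime factor p of r.  If p = 2 or p = 3 mod 4, there is only
    one prime above p, and the norm determines the valuation of z at it.  If
    p = 1 mod 4, the valuation of z at one place is a multiple of n by assumption
    and the sum of the two is a multiple of n by the norm, so at least one of the
    two is n or more. *)
Lemma gint_extract_power (n r : nat) (z : gint) : odd n -> (1 < r)%N ->
  gauss_norm z = (r ^ n)%N -> power_locally n z ->
  exists2 pi : gint, 1 < gauss_norm pi & gdvd (pi ^+ n) z.
Proof.
move=> n_odd r1 nz zP; have r0 : (0 < r)%N by apply: ltnW.
pose p := pdiv r; have p_pr : prime p by apply: pdiv_prime.
have pr : (p %| r)%N by apply: pdiv_dvd.
have n0 : (0 < n)%N by case: (n) n_odd.
have [p2|p_odd] := even_prime p_pr.
  exists (Gauss 1 1) => //; apply: gdvd_two_exp.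
  by rewrite nz dvdzE abszX; apply: dvdn_exp2r; rewrite [X in (X %| _)%N](_ : _ = p).
have /orP[/eqP p1|/eqP p3] : (p == 1 %[mod 4])%N || (p == 3 %[mod 4])%N.
- by lia.
- have [J [JJ [k [J0 zk]]]] := zP (Prime p_pr) p1.
  have [pi pin piP] := split_prime JJ J0.
  have p1' : 1 < (p : int) by have := prime_gt1 p_pr; lia.
  have nz0 : gauss_norm z != 0 by rewrite nz; have := expn_gt0 r n; lia.
  have [k0|k0] : k = 0 \/ 1 <= k; last 1 first.
  + exists pi; first by rewrite pin.
    by apply: piP; apply/(has_val_ge _ zk); nia.
  + have : 0 <= k *+ n by apply/(has_val_ge _ zk); apply: gint_eval_int.
    nia.
  (* z is a unit at the place of pi, so all of its norm comes from the conjugate. *)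
  exists (gauss_conj pi); first by rewrite gauss_norm_conj pin.
  rewrite -[z]gauss_conjK; apply: gdvd_conj; rewrite rmorphXn /= gauss_conjK; apply: piP.
  have [l lP] : exists l, has_val (gint_eval JJ (gauss_conj z)) l.
    by apply/has_val_exists/(gint_eval_neq0 JJ); rewrite gauss_norm_conj.
  apply/(has_val_ge _ lP); have := has_valM zk lP; rewrite gint_eval_norm k0 mul0rn add0r.
  rewrite -(rmorph_int (Qp_of_rat _)) => h.
  have h' := @has_val_rat (Prime p_pr) (gauss_norm z)%:~R.
  rewrite intr_eq0 in h'; rewrite (has_val_uniq h (h' nz0)) padic_val_int // nz /=.
  by rewrite lez_nat lognX leq_pmulr // logn_gt0 mem_primes p_pr pr r0.
exists (p%:Z%:~R).
  by rewrite gint_intE /gauss_norm /= expr0n addr0; have := prime_gt1 p_pr; nia.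
apply: gdvd_inert => //; rewrite nz dvdzE /=.
(* p^n divides the norm and n is odd, so p divides z (n + 1) / 2 times and p^(n+1)
   divides the norm r^n; hence p^2 divides r. *)
have [m nE] : exists m, n = m.*2.+1.
  by exists n./2; rewrite -{1}(odd_double_half n) n_odd.
have [|w zE] := @gdvd_inert p m.+1 z p_pr p3.
  by rewrite nz dvdzE doubleS /= -nE dvdn_exp2r.
have : (p ^ n.+1 %| r ^ n)%N.
  have : ((p ^ n.+1)%N%:Z %| gauss_norm z)%Z.
    rewrite zE gauss_normM gauss_normX.
    have -> : gauss_norm (p%:Z%:~R : gint) = p%:Z ^+ 2.
      by rewrite gint_intE /gauss_norm /= expr0n addr0.
    by rewrite -exprM mul2n nE -doubleS; apply: dvdz_mulr; rewrite dvdzE abszX.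
  by rewrite nz dvdzE.
rewrite pfactor_dvdn ?expn_gt0 ?r0 // lognX => h.
have l2 : (2 <= logn p r)%N by rewrite ltnNge; apply/negP => l2; nia.
rewrite pfactor_dvdn ?expn_gt0 ?r0 // lognX.
by apply: leq_trans (leq_pred _) _; rewrite -muln2 leq_mul2l l2 orbT.
Qed.

(** Descent on r.  At the end z is a unit, so z^4 = 1, and z = (z^n)^n because
    n^2 = 1 mod 4. *)
Lemma gint_power (n r : nat) (z : gint) : odd n -> (0 < r)%N ->
  gauss_norm z = (r ^ n)%N -> power_locally n z -> exists w, z = w ^+ n.
Proof.
move=> n_odd; have n0 : (0 < n)%N by case: (n) n_odd.
elim/ltn_ind: r z => r IH z r0 nz zP.
have [r1|r1] := leqP r 1.
  have {r0 r1} r1 : r = 1%N by lia.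
  rewrite r1 exp1n in nz; exists (z ^+ n); rewrite -exprM.
  have z4 : z ^+ 4 = 1.
    have : (z = Gauss 1 0 \/ z = Gauss (-1) 0) \/ (z = Gauss 0 1 \/ z = Gauss 0 (-1)).
      case: z nz {zP} => x y; rewrite /gauss_norm /= => nz.
      have : (x = 1 /\ y = 0 \/ x = -1 /\ y = 0) \/ (x = 0 /\ y = 1 \/ x = 0 /\ y = -1) by nia.
      by case=> -[] [-> ->]; auto.
    by case=> -[] ->; congr Gauss.
  rewrite (divn_eq (n * n) 4) (_ : (n * n) %% 4 = 1)%N; last first.
    by rewrite -(odd_double_half n) n_odd; lia.
  by rewrite exprD mulnC exprM z4 expr1n mul1r.
have [pi pi1 [w zE]] := gint_extract_power n_odd r1 nz zP.
have [d dE] : exists d : nat, gauss_norm pi = d.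
  by exists `|gauss_norm pi|%N; rewrite gez0_abs // ltW // (lt_trans ltr01).
have d1 : (1 < d)%N by lia.
move: nz; rewrite zE gauss_normM gauss_normX dE => nz.
have /dvdnP[s rE] : (d %| r)%N.
  have : (d ^ n %| r ^ n)%N.
    have : (d%:Z ^+ n %| ((r ^ n)%N)%:Z)%Z by rewrite -nz dvdz_mulr.
    by rewrite dvdzE abszX.
  by rewrite dvdn_pexp2r.
have s0 : (0 < s)%N by move: r0; rewrite rE; case: (s).
have [||||u uE] := IH s _ w; last by exists (pi * u); rewrite uE exprMn.
- by rewrite rE ltn_Pmulr.
- exact: s0.
- apply: (mulfI (_ : d%:Z ^+ n != 0)); first by rewrite expf_neq0 //; lia.
  by rewrite nz rE expnMn PoszM mulrC; congr (_ * _); rewrite -[LHS]natz natrX natz.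
move=> p p1; have [J [JJ [k [J0 kP]]]] := zP p p1; exists J, JJ.
have [l lP] : exists l, has_val (gint_eval JJ pi) l.
  by apply/has_val_exists/(gint_eval_neq0 JJ); lia.
exists (k - l); split=> //.
have -> : gint_eval JJ w = gint_eval JJ z * (gint_eval JJ pi ^+ n)^-1.
  by rewrite zE rmorphM rmorphXn /= mulrAC mulfV ?mul1r // expf_neq0 //; case: lP.
by rewrite mulrnBl; apply: has_valM => //; apply/has_valV/has_valX.
Qed.

Lemma rat_root_int (s : rat) (n : nat) (m : int) : (0 < n)%N ->
  s ^+ n = m%:~R -> exists k : int, s = k%:~R.
Proof.
move=> n0 sm; exists (numq s).
have : numq s ^+ n = m * denq s ^+ n.
  apply: (@intr_inj rat); rewrite rmorphM !rmorphXn /= numqE exprMn sm.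
  by [].
move/(congr1 absz); rewrite abszM !abszX => E.
have : (`|denq s| %| `|numq s|)%N by rewrite -(dvdn_pexp2r _ _ n0) E dvdn_mull.
move/gcdn_idPr; rewrite (eqP (coprime_num_den s)) => d1.
have : denq s = 1 by have := denq_gt0 s; lia.
by rewrite numqE => ->; rewrite mulr1.
Qed.

Definition padic_place (p : prime_number) (J : Qp p) (JJ : J ^+ 2 = -1) : L -> Qp p :=
  gauss_eval JJ \o gauss_map (Qp_of_rat p).
HB.instance Definition _ p J JJ := GRing.RMorphism.on (@padic_place p J JJ).

Lemma padic_place_rat p J JJ (r : rat) : @padic_place p J JJ (Gauss r 0) = Qp_of_rat p r.
Proof. by rewrite /padic_place /gauss_eval /= rmorph0 mulr0 addr0. Qed.

Lemma padic_place_int p J JJ (z : gauss int) :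
  @padic_place p J JJ (gauss_map intr z) = gint_eval JJ z.
Proof. by rewrite /padic_place /gint_eval /gauss_eval /= !rmorph_int. Qed.

(** Multiplying c by the n-th power of a common denominator reduces this to
    Gaussian integers. *)
Lemma gauss_rat_power (n : nat) (c : L) (r : rat) : odd n -> c != 0 ->
  gauss_norm c = r ^+ n ->
  (forall p : prime_number, (p = 1 %[mod 4])%N ->
    exists (J : Qp p) (JJ : J ^+ 2 = -1) (k : int),
      padic_int J /\ has_val (padic_place JJ c) (k *+ n)) ->
  exists w, c = w ^+ n.
Proof.
move=> n_odd c0 nc cP; have n0 : (0 < n)%N by case: (n) n_odd.
pose d : int := denq (gre c) * denq (gim c).
have d0 : d != 0 by rewrite mulf_neq0 ?denq_neq0.
pose dn := d ^+ n.-1.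
pose z : gauss int := Gauss (numq (gre c) * denq (gim c) * dn) (numq (gim c) * denq (gre c) * dn).
have zE : gauss_map intr z = c * (d%:~R) ^+ n :> L.
  rewrite -[in RHS](prednK n0) exprS gauss_intE.
  have -> : (Gauss d%:~R 0 : L) ^+ n.-1 = Gauss dn%:~R 0.
    by rewrite -gauss_intE -rmorphXn /= gauss_intE.
  congr Gauss; rewrite /= !mulr0 !mul0r ?subr0 ?addr0 ?add0r !rmorphM /= numqE; ring.
have dL0 : (d%:~R : L) != 0.
  by rewrite gauss_intE; apply: contraNneq d0 => -[/eqP]; rewrite intr_eq0.
have nz : (gauss_norm z)%:~R = (r * d%:~R ^+ 2) ^+ n :> rat.
  transitivity (gauss_norm (gauss_map intr z : L)); first by rewrite /gauss_norm rmorphD !rmorphXn.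
  rewrite zE gauss_normM gauss_normX nc exprMn; congr (_ * _ ^+ n).
  by rewrite gauss_intE /gauss_norm /= expr0n addr0.
have [s sE] := rat_root_int n0 (esym nz).
have z0 : z != 0.
  apply/eqP => z0; move/eqP: zE; rewrite z0 rmorph0 eq_sym mulf_eq0 (negPf c0) expf_eq0.
  by rewrite (negPf dL0) andbF.
have nz0 : 0 < gauss_norm z.
  case: (z) z0 => x y; rewrite /gauss_norm /= => xy.
  rewrite lt0r addr_ge0 ?sqr_ge0 // andbT paddr_eq0 ?sqr_ge0 // !expf_eq0 /=.
  by apply: contra xy => /andP[/eqP-> /eqP->].
have nzs : gauss_norm z = (`|s| ^ n)%N.
  have : gauss_norm z = s ^+ n by apply: (@intr_inj rat); rewrite nz sE rmorphXn.
  move=> E; rewrite -[LHS]gez0_abs ?ltW // E abszX //.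
have s0 : (0 < `|s|)%N.
  by move: nz0; rewrite nzs ltz_nat expn_gt0 => /orP[//|/eqP n0']; rewrite n0' in n0.
have [|w wE] := gint_power n_odd s0 nzs.
  move=> p p1; have [J [JJ [k [J0 kP]]]] := cP p p1; exists J, JJ.
  have d0' : (d%:~R : rat) != 0 by rewrite intr_eq0.
  exists (k + padic_val p d%:~R); split=> //.
  have -> : gint_eval JJ z = padic_place JJ c * Qp_of_rat p d%:~R ^+ n.
    rewrite -(padic_place_rat JJ) -gauss_intE -rmorphXn -rmorphM -zE.
    by rewrite [RHS]padic_place_int.
  by rewrite mulrnDl; apply: has_valM => //; apply/has_valX/has_val_rat.
exists (gauss_map intr w / d%:~R); rewrite expr_div_n -rmorphXn -wE /= zE.
by rewrite mulfK // expf_neq0.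
Qed.

(** * Special unitary groups over split algebras *)

(** Hence ring morphisms between Q-algebras are compatible with the structure
    maps. *)
Lemma rat_rmorphism_unique (R : pzRingType) (f g : {rmorphism rat -> R}) : f =1 g.
Proof.
move=> r; have d0 : (denq r)%:~R != 0 :> rat by rewrite intr_eq0 denq_neq0.
have fd : f ((denq r)%:~R^-1) = g ((denq r)%:~R^-1).
  have fg : f (denq r)%:~R = g (denq r)%:~R by rewrite !rmorph_int.
  have f1 : f ((denq r)%:~R^-1) * f (denq r)%:~R = 1 by rewrite -rmorphM mulVf ?rmorph1.
  have g1 : g (denq r)%:~R * g ((denq r)%:~R^-1) = 1 by rewrite -rmorphM mulfV ?rmorph1.
  by rewrite -[LHS]mulr1 -g1 mulrA -fg f1 mul1r.
by rewrite -[r]divq_num_den !rmorphM fd !rmorph_int.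
Qed.

(** The group scheme SU is defined on objects of [comAlgType rat]; this makes one
    out of any ring that receives a morphism from Q. *)
Definition under_rat (A : comNzRingType) of {rmorphism rat -> A} : Type := A.

Section UnderRat.
Variables (A : comNzRingType) (f : {rmorphism rat -> A}).
HB.instance Definition _ := GRing.ComNzRing.on (under_rat f).
Let scale (r : rat) (x : under_rat f) : under_rat f := (f r : under_rat f) * x.
Lemma under_rat_scaleA a b v : scale a (scale b v) = scale (a * b) v.
Proof. by rewrite /scale rmorphM mulrA. Qed.
Lemma under_rat_scale1 : left_id 1 scale.
Proof. by move=> v; rewrite /scale rmorph1 mul1r. Qed.
Lemma under_rat_scaleDr : right_distributive scale +%R.
Proof. by move=> a u v; rewrite /scale mulrDr. Qed.
Lemma under_rat_scaleDl v : {morph scale^~ v : a b / a + b}.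
Proof. by move=> a b; rewrite /scale rmorphD mulrDl. Qed.
HB.instance Definition _ := GRing.Zmodule_isLmodule.Build rat (under_rat f)
  under_rat_scaleA under_rat_scale1 under_rat_scaleDr under_rat_scaleDl.
Lemma under_rat_scaleAl (a : rat) (u v : under_rat f) : a *: (u * v) = a *: u * v.
Proof. by rewrite /GRing.scale /= /scale mulrA. Qed.
HB.instance Definition _ := GRing.Lmodule_isLalgebra.Build rat (under_rat f) under_rat_scaleAl.
Lemma under_rat_scaleAr (a : rat) (u v : under_rat f) : a *: (u * v) = u * (a *: v).
Proof. by rewrite mulrC under_rat_scaleAl mulrC. Qed.
HB.instance Definition _ := GRing.Lalgebra_isAlgebra.Build rat (under_rat f) under_rat_scaleAr.
End UnderRat.

Section Split.
Variables (R : comAlgType rat) (J : R) (JJ : J ^+ 2 = -1).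
Local Notation phi := (gauss_eval JJ).

(** Inverse of z |-> (z at i = J, z at i = - J); the inverse of 2 J is - J / 2. *)
Definition gauss_split (s t : R) : gauss R := Gauss (2^-1 *: (s + t)) (- (2^-1 *: (J * (s - t)))).

Let half2 (x : R) : 2^-1 *: (x + x) = x.
Proof. by rewrite -mulr2n -scaler_nat scalerA mulVf // scale1r. Qed.

Lemma gauss_evalK s t : phi (gauss_split s t) = s.
Proof.
rewrite /gauss_eval /= mulrN -scalerAr mulrA -expr2 JJ mulN1r scalerN opprK -scalerDr.
by rewrite addrACA subrr addr0 half2.
Qed.

Lemma gauss_eval_conjK s t : phi (gauss_conj (gauss_split s t)) = t.
Proof.
rewrite /gauss_eval /= opprK -scalerAr mulrA -expr2 JJ mulN1r -scalerDr.
by rewrite opprB addrC addrA subrK half2.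
Qed.

Lemma gauss_split_eval z : gauss_split (phi z) (phi (gauss_conj z)) = z.
Proof.
case: z => a b; rewrite /gauss_eval /gauss_split /=; congr Gauss.
  by rewrite mulrN addrACA subrr addr0 half2.
rewrite mulrN opprD opprK addrACA subrr add0r mulrDr mulrA -expr2 JJ mulN1r.
by rewrite -opprD scalerN opprK half2.
Qed.

Lemma gauss_eval_inj z w :
  phi z = phi w -> phi (gauss_conj z) = phi (gauss_conj w) -> z = w.
Proof. by move=> zw zw'; rewrite -[z]gauss_split_eval zw zw' gauss_split_eval. Qed.
End Split.

Lemma isometry_dual (T : comNzRingType) (n : nat) (M N k k' : 'M[T]_n) :
  N *m M = 1%:M -> \det k = 1 -> k *m M *m k' = M -> k' = N *m \adj k *m M.
Proof.
move=> NM k1 kU; rewrite -[in RHS]kU !mulmxA -(mulmxA N) mul_adj_mx k1 mulmx1 NM.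
by rewrite mul1mx.
Qed.

Section SpecialUnitaryPoints.
Variables (n : nat) (q : {hermitian 'rV[L]_n for false & sigma}).
Hypothesis q_nondeg : nondegenerate q.

Lemma gram_unit : matrix_of_form q \in unitmx.
Proof.
rewrite -row_free_unit -kermx_eq0; apply/eqP/row_matrixP => i; rewrite row0.
set v := row i _; have vM : v *m matrix_of_form q = 0.
  by apply/sub_kermxP; rewrite row_sub.
have : v \in orthov q fullv.
  apply/mem_orthovP => w _; rewrite -[LHS](matrix_of_formK q) /form_of_matrix vM mul0mx.
  by rewrite linear0.
by rewrite (eqP q_nondeg) memv0 => /eqP.
Qed.

Lemma gram_conj (R : comAlgType rat) : map_mx (@gauss_conj R) (gram q R) = (gram q R)^T.
Proof.
apply/matrixP => i j; rewrite !mxE -(gauss_map_conj (in_alg R)); congr gauss_map.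
by rewrite [in RHS]hermC expr0 mul1r.
Qed.

Lemma gram_inv (R : comAlgType rat) :
  exists M : 'M[gauss R]_n, gram q R *m M = 1%:M /\ M *m gram q R = 1%:M.
Proof.
exists (map_mx (gauss_map (in_alg R)) (invmx (matrix_of_form q))).
by rewrite /gram -!map_mxM mulmxV ?mulVmx ?gram_unit // !map_mx1.
Qed.

Section SplitPoints.
Variables (R : comAlgType rat) (J : R) (JJ : J ^+ 2 = -1).
Local Notation phi := (gauss_eval JJ).
Local Notation psi := (phi \o @gauss_conj R).

Lemma map_eval_conj (g : 'M[gauss R]_n) : map_mx phi (map_mx (@gauss_conj R) g) = map_mx psi g.
Proof. by apply/matrixP => i j; rewrite !mxE. Qed.
Lemma map_eval_conjK (g : 'M[gauss R]_n) : map_mx psi (map_mx (@gauss_conj R) g) = map_mx phi g.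
Proof. by apply/matrixP => i j; rewrite !mxE /= gauss_conjK. Qed.

Lemma gauss_mx_inj (g h : 'M[gauss R]_n) :
  map_mx phi g = map_mx phi h -> map_mx psi g = map_mx psi h -> g = h.
Proof.
move=> /matrixP e1 /matrixP e2; apply/matrixP => i j.
apply: (gauss_eval_inj (JJ := JJ)); first by have := e1 i j; rewrite !mxE.
by have := e2 i j; rewrite !mxE.
Qed.

(** With a square root of -1 in R, the ring R[i] is R x R and conjugation
    exchanges the factors.  The unitary equation then expresses the second
    component of a point by its first component A, which is any matrix of
    determinant 1. *)
Lemma SU_split (A : 'M[R]_n) : \det A = 1 -> exists2 g, SU q g & map_mx phi g = A.
Proof.
move=> A1; have [N [MN NM]] := gram_inv R.
pose M1 := map_mx phi (gram q R); pose N1 := map_mx phi N.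
have MN1 : M1 *m N1 = 1%:M by rewrite /M1 /N1 -map_mxM MN map_mx1.
have NM1 : N1 *m M1 = 1%:M by rewrite /M1 /N1 -map_mxM NM map_mx1.
have M2 : map_mx psi (gram q R) = M1^T by rewrite -map_eval_conj gram_conj -map_trmx.
pose A' := \adj A; have AA' : A *m A' = 1%:M by rewrite mul_mx_adj A1.
pose B := (N1 *m A' *m M1)^T.
pose g : 'M[gauss R]_n := \matrix_(i, j) gauss_split J (A i j) (B i j).
have gA : map_mx phi g = A by apply/matrixP => i j; rewrite !mxE gauss_evalK.
have gB : map_mx psi g = B by apply/matrixP => i j; rewrite !mxE /= gauss_eval_conjK.
have E1 : A *m M1 *m B^T = M1.
  by rewrite trmxK !mulmxA -(mulmxA A) MN1 mulmx1 AA' mul1mx.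
exists g => //; split.
  apply: gauss_mx_inj; rewrite !map_mxM -map_trmx.
    by rewrite map_eval_conj gA gB.
  by rewrite map_eval_conjK gA gB M2 -[in RHS]E1 !trmx_mul trmxK mulmxA.
have phi_det : phi (\det g) = \det (map_mx phi g) by rewrite det_map_mx.
have psi_det : psi (\det g) = \det (map_mx psi g) by rewrite det_map_mx.
apply: (gauss_eval_inj (JJ := JJ)); first by rewrite phi_det gA A1 rmorph1.
rewrite -[LHS]/(psi _) -[RHS]/(psi _) rmorph1 psi_det gB det_tr !det_mulmx.
have dA' : \det A' = 1 by have := congr1 determinant AA'; rewrite det_mulmx A1 mul1r det1.
by rewrite dA' mulr1 -det_mulmx NM1 det1.
Qed.

Lemma SU_split_inj (g h : 'M[gauss R]_n) :
  SU q g -> SU q h -> map_mx phi g = map_mx phi h -> g = h.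
Proof.
have [N [MN NM]] := gram_inv R.
have psiE k : SU q k -> (map_mx psi k)^T =
    map_mx phi N *m \adj (map_mx phi k) *m map_mx phi (gram q R).
  move=> [kU k1]; rewrite -(map_eval_conj k) map_trmx (isometry_dual NM k1 kU).
  by rewrite map_mxM; congr (_ *m _); rewrite map_mxM map_mx_adj.
move=> gU hU gh; apply: gauss_mx_inj => //; apply: trmx_inj.
have := psiE g gU; rewrite gh => eg; exact: etrans eg (esym (psiE h hU)).
Qed.

End SplitPoints.

Lemma SU_scalar (R : comAlgType rat) (z : gauss R) :
  z * gauss_conj z = 1 -> z ^+ n = 1 -> SU_center q (z%:M : 'M_n).
Proof.
move=> zz zn; split=> [|R' h g _]; last first.
  by rewrite map_scalar_mx scalar_mxC.
split; last by rewrite det_scalar.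
by rewrite map_scalar_mx tr_scalar_mx mul_scalar_mx mul_mx_scalar scalerA mulrC zz scale1r.
Qed.

Lemma det_transvection (R : comNzRingType) (i j : 'I_n) : i != j ->
  \det (1%:M + delta_mx i j : 'M[R]_n) = 1.
Proof.
have low (a b : 'I_n) : (b < a)%N -> \det (1%:M + delta_mx a b : 'M[R]_n) = 1.
  move=> ba; rewrite det_trig.
    rewrite big1 // => k _; rewrite !mxE eqxx; case: eqP => [->|]; last by rewrite addr0.
    by rewrite -val_eqE /= gtn_eqF // addr0.
  apply/is_trig_mxP => k l kl; rewrite !mxE -[k == l]val_eqE ltn_eqF // add0r.
  by case: eqP => //= ka; case: eqP => //= lb; move: kl; rewrite ka lb ltnNge ltnW.
move=> ij; case: (ltngtP i j) => [lt|gt|/val_inj E]; last by rewrite E eqxx in ij.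
  by rewrite -det_tr linearD /= trmx1 trmx_delta low.
exact: low.
Qed.

End SpecialUnitaryPoints.

(** * The centre *)

Section Split.
Variable R : comAlgType rat.
(** R[i] as an algebra that contains a square root of -1: base change to it
    splits the group over any R. *)
Definition gauss_alg := under_rat (@gauss_const R \o in_alg R).
HB.instance Definition _ := GRing.ComAlgebra.on gauss_alg.
Definition to_gauss_alg : R -> gauss_alg := @gauss_const R.
HB.instance Definition _ := GRing.RMorphism.on to_gauss_alg.
Lemma to_gauss_alg_scalable : scalable to_gauss_alg.
Proof.
move=> a x; rewrite -[a *: x]mulr_algl rmorphM /=.
by [].
Qed.
HB.instance Definition _ := GRing.isScalable.Build rat R gauss_alg *:%R
   to_gauss_alg to_gauss_alg_scalable.
Definition gauss_i : gauss_alg := Gauss 0 1.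
Lemma gauss_iK : gauss_i ^+ 2 = -1.
Proof. by congr Gauss; rewrite /= !(mulr0, mul0r, mulr1) ?add0r ?addr0 ?oppr0. Qed.

Lemma gauss_eval_i z : gauss_eval gauss_iK (gauss_map to_gauss_alg z) = z.
Proof.
by case: z => a b; congr Gauss; rewrite /= !(mulr0, mul0r, mul1r, subr0, addr0, add0r).
Qed.
End Split.

Section Center.
Variables (n : nat) (q : {hermitian 'rV[L]_n for false & sigma}).
Hypothesis q_nondeg : nondegenerate q.

(** Over R[i] the group contains all transvections, and a matrix that commutes
    with these is scalar. *)
Lemma SU_center_scalar (R : comAlgType rat) (z : 'M[gauss R]_n) : (0 < n)%N ->
  SU_center q z -> exists c : gauss R,
    [/\ z = c%:M, c * gauss_conj c = 1 & c ^+ n = 1].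
Proof.
move=> n0 [[zU z1] zC]; pose i0 := Ordinal n0.
have zE : map_mx (gauss_eval (gauss_iK R)) (map_mx (gauss_map (@to_gauss_alg R)) z) = z.
  by apply/matrixP => i j; rewrite !mxE gauss_eval_i.
have comm (A : 'M[gauss_alg R]_n) : \det A = 1 -> (z : 'M[gauss_alg R]_n) *m A = A *m z.
  move=> /(SU_split q_nondeg (gauss_iK R))[g gU <-].
  have := congr1 (map_mx (gauss_eval (gauss_iK R))) (zC (gauss_alg R) (@to_gauss_alg R) g gU).
  by rewrite !map_mxM /= zE.
have comE (i j : 'I_n) : i != j ->
    (z : 'M[gauss_alg R]_n) *m delta_mx i j = delta_mx i j *m z.
  move=> ij; have := comm _ (det_transvection _ ij).
  by rewrite mulmxDr mulmxDl mulmx1 mul1mx => /addrI.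
have entry (i j : 'I_n) : i != j -> z j i = 0 /\ z i i = z j j.
  move=> ij; have /matrixP e := comE i j ij; split.
    have := e j j; rewrite !mxE (bigD1 i) //= big1 => [|k ki]; last first.
      by rewrite !mxE (negPf ki) mulr0.
    rewrite big1 => [|k _]; last by rewrite !mxE eq_sym (negPf ij) mul0r.
    by rewrite !mxE !eqxx mulr1 addr0.
  have := e i j; rewrite !mxE (bigD1 i) //= big1 => [|k ki]; last first.
    by rewrite !mxE (negPf ki) mulr0.
  rewrite (bigD1 j) //= big1 => [|k ki]; last by rewrite !mxE (negPf ki) andbF mul0r.
  by rewrite !mxE !eqxx mulr1 mul1r !addr0.
have zS : z = (z i0 i0)%:M.
  apply/matrixP => i j; rewrite !mxE; have [->|ij] := eqVneq i j.
    have [->|ij] := eqVneq j i0; first by rewrite mulr1n.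
    by rewrite mulr1n; case: (entry j i0 ij).
  by rewrite mulr0n; case: (entry j i) => //; rewrite eq_sym.
exists (z i0 i0); split=> //; last by rewrite -det_scalar -zS.
have [N [MN NM]] := gram_inv q_nondeg R.
move: zU; rewrite zS map_scalar_mx tr_scalar_mx mul_scalar_mx mul_mx_scalar scalerA mulrC.
move/(congr1 (mulmx^~ N)); rewrite -scalemxAl MN => /matrixP/(_ i0 i0).
by rewrite !mxE eqxx !mulr1n mulr1.
Qed.
End Center.

(** * Monomials in the matrix entries as functions on G *)

Section RegularFunctions.
Variables (n : nat) (q : {hermitian 'rV[L]_n for false & sigma}).
Hypothesis q_nondeg : nondegenerate q.

Definition coord_var (k : coord_index n) : coord_poly n :=
  mpoly.mpolyX rat (mpoly.mnm1 (enum_rank k)).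

Definition generic_mx (i j : 'I_n) : gauss (coord_poly n) :=
  Gauss (coord_var (false, i, j)) (coord_var (true, i, j)).

Lemma eval_generic_mx (R : comAlgType rat) (g : 'M[gauss R]_n) i j :
  gauss_map (eval_poly g) (generic_mx i j) = g i j.
Proof.
rewrite [RHS](_ : _ = Gauss (gre (g i j)) (gim (g i j))); last by case: (g i j).
by congr Gauss; rewrite /eval_poly mpoly.mmapX mpoly.mmap1U /Defs.coord enum_rankK.
Qed.

Section Eval.
Variables (R : comAlgType rat) (g : 'M[gauss R]_n) (gU : SU q g).
Definition adjoint_eval of SU q g := fun f : adjoint_ring q => evalSU g f.
Lemma adjoint_eval_zmod : zmod_morphism (adjoint_eval gU).
Proof. by move=> f f'; rewrite /adjoint_eval [adjoint_val _](rmorphB val) evalSUB. Qed.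
HB.instance Definition _ := GRing.isZmodMorphism.Build (adjoint_ring q) R
  (adjoint_eval gU) adjoint_eval_zmod.
Lemma adjoint_eval_monoid : monoid_morphism (adjoint_eval gU).
Proof.
split=> [|f f']; first by rewrite /adjoint_eval [adjoint_val _](rmorph1 val) evalSU1.
by rewrite /adjoint_eval [adjoint_val _](rmorphM val) evalSUM.
Qed.
HB.instance Definition _ := GRing.isMonoidMorphism.Build (adjoint_ring q) R
  (adjoint_eval gU) adjoint_eval_monoid.
End Eval.

Lemma adjoint_ext (f f' : adjoint_ring q) :
  (forall (R : comAlgType rat) (g : 'M[gauss R]_n) (gU : SU q g),
     adjoint_eval gU f = adjoint_eval gU f') -> f = f'.
Proof.
move=> ff'; apply: val_inj; apply/eqP.
have -> : val f = \pi_(SU_ring q)%qT (repr (val f)) by rewrite reprK.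
have -> : val f' = \pi_(SU_ring q)%qT (repr (val f')) by rewrite reprK.
rewrite -Quotient.idealrBE; apply/asboolP => R g gU.
by rewrite rmorphB /=; apply/eqP; rewrite subr_eq0; apply/eqP; apply: ff'.
Qed.

Lemma gauss_adjoint_ext (F F' : gauss (adjoint_ring q)) :
  (forall (R : comAlgType rat) (g : 'M[gauss R]_n) (gU : SU q g),
     gauss_map (adjoint_eval gU) F = gauss_map (adjoint_eval gU) F') -> F = F'.
Proof.
move=> FF'; case: F F' FF' => a b [a' b'] FF'; congr Gauss; apply: adjoint_ext => R g gU.
  by case: (FF' R g gU).
by case: (FF' R g gU).
Qed.

Lemma evalSU_natural (R R' : comAlgType rat) (h : {rmorphism R -> R'})
    (g : 'M[gauss R]_n) (f : SU_ring q) :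
  evalSU (map_mx (gauss_map h) g) f = h (evalSU g f).
Proof.
rewrite /evalSU /eval_poly /mpoly.mmap rmorph_sum; apply: eq_bigr => m _; rewrite rmorphM.
congr (_ * _); first exact: (rat_rmorphism_unique (in_alg R') (h \o in_alg R)).
rewrite /mpoly.mmap1 rmorph_prod; apply: eq_bigr => k _; rewrite rmorphXn; congr (_ ^+ _).
by rewrite /Defs.coord; case: (enum_val k) => [[[] i] j]; rewrite mxE.
Qed.

Lemma adjoint_memP (P : coord_poly n) :
  (forall (R : comAlgType rat) (g z : 'M[gauss R]_n), SU q g -> SU_center q z ->
     eval_poly (g *m z) P = eval_poly g P) -> (\pi_(SU_ring q) P)%qT \in @adjoint_pred n q.
Proof.
move=> PP; apply/asboolP => R g z gU zZ.
by rewrite !evalSU_pi ?PP //; apply: SUM zZ.1.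
Qed.

Section Monomials.
Hypothesis n_gt0 : (0 < n)%N.
Implicit Types I J K : {ffun 'I_n -> 'I_n}.

Definition monomial_poly I J : gauss (coord_poly n) := \prod_t generic_mx (I t) (J t).

Lemma eval_monomial_poly (R : comAlgType rat) (g : 'M[gauss R]_n) I J :
  gauss_map (eval_poly g) (monomial_poly I J) = \prod_t g (I t) (J t).
Proof. by rewrite rmorph_prod; apply: eq_bigr => t _; apply: eval_generic_mx. Qed.

Lemma monomial_poly_invariant (R : comAlgType rat) (g z : 'M[gauss R]_n) I J :
  SU q g -> SU_center q z ->
  gauss_map (eval_poly (g *m z)) (monomial_poly I J) =
  gauss_map (eval_poly g) (monomial_poly I J).
Proof.
move=> gU zZ; have [c [zE cc cn]] := SU_center_scalar q_nondeg n_gt0 zZ.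
rewrite !eval_monomial_poly zE.
under eq_bigr => t _ do rewrite mul_mx_scalar mxE.
by rewrite big_split /= prodr_const card_ord cn mul1r.
Qed.

Lemma monomial_re I J : (\pi_(SU_ring q) (gre (monomial_poly I J)))%qT \in @adjoint_pred n q.
Proof.
by apply: adjoint_memP => R g z gU zZ; have [] := monomial_poly_invariant I J gU zZ.
Qed.
Lemma monomial_im I J : (\pi_(SU_ring q) (gim (monomial_poly I J)))%qT \in @adjoint_pred n q.
Proof.
by apply: adjoint_memP => R g z gU zZ; have [] := monomial_poly_invariant I J gU zZ.
Qed.

(** The entry (I, J) of the n-th tensor power of the standard representation.  The
    degree n makes it invariant under scalars c with c^n = 1. *)
Definition monomial I J : gauss (adjoint_ring q) :=
  Gauss (AdjointFun (monomial_re I J)) (AdjointFun (monomial_im I J)).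

Lemma monomialE (R : comAlgType rat) (g : 'M[gauss R]_n) (gU : SU q g) I J :
  gauss_map (adjoint_eval gU) (monomial I J) = \prod_t g (I t) (J t).
Proof.
by rewrite -eval_monomial_poly; congr Gauss; rewrite /adjoint_eval /= evalSU_pi.
Qed.

Definition ffconst (i : 'I_n) : {ffun 'I_n -> 'I_n} := [ffun=> i].

Lemma monomialX I J : monomial I J ^+ n = \prod_t monomial (ffconst (I t)) (ffconst (J t)).
Proof.
apply: gauss_adjoint_ext => R g gU; rewrite rmorphXn rmorph_prod /= monomialE -prodrXl.
apply: eq_bigr => t _; rewrite monomialE.
by under [in RHS]eq_bigr do rewrite !ffunE; rewrite prodr_const card_ord.
Qed.

(** Leibniz' formula for the determinant 1 of a point of SU_n(q). *)
Lemma monomial_det :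
  \sum_(s : 'S_n) (-1) ^+ s * monomial (finfun id) (finfun s) = 1.
Proof.
apply: gauss_adjoint_ext => R g gU; rewrite rmorph_sum rmorph1.
rewrite -[RHS](proj2 gU); apply: eq_bigr => s _.
rewrite rmorphM rmorph_sign /= monomialE; congr (_ * _).
by apply: eq_bigr => t _; rewrite !ffunE.
Qed.

Definition entry_norm_poly (i j : 'I_n) : coord_poly n := gauss_norm (generic_mx i j).

Lemma eval_entry_norm_poly (R : comAlgType rat) (g : 'M[gauss R]_n) i j :
  eval_poly g (entry_norm_poly i j) = gauss_norm (g i j).
Proof. by rewrite -eval_generic_mx /gauss_norm /= rmorphD !rmorphXn. Qed.

Lemma entry_norm_mem i j : (\pi_(SU_ring q) (entry_norm_poly i j))%qT \in @adjoint_pred n q.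
Proof.
apply: adjoint_memP => R g z gU zZ; have [c [zE cc cn]] := SU_center_scalar q_nondeg n_gt0 zZ.
rewrite !eval_entry_norm_poly zE mul_mx_scalar mxE gauss_normM.
suff -> : gauss_norm c = 1 by rewrite mul1r.
by have := congr1 (@gre R) cc; rewrite /gauss_norm /= mulrN opprK -!expr2.
Qed.

Definition entry_norm i j := AdjointFun (entry_norm_mem i j).

(** So at a rational point the left hand side is an n-th power in Q. *)
Lemma monomial_norm i j : gauss_norm (monomial (ffconst i) (ffconst j)) = entry_norm i j ^+ n.
Proof.
apply: adjoint_ext => R g gU.
have -> : adjoint_eval gU (gauss_norm (monomial (ffconst i) (ffconst j))) =
    gauss_norm (gauss_map (adjoint_eval gU) (monomial (ffconst i) (ffconst j))).
  by rewrite /gauss_norm rmorphD !rmorphXn.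
rewrite monomialE; under eq_bigr do rewrite !ffunE.
rewrite prodr_const card_ord gauss_normX rmorphXn /=; congr (_ ^+ _).
rewrite -[RHS]/(evalSU g (\pi_(SU_ring q) (entry_norm_poly i j))%qT) evalSU_pi //.
by rewrite eval_entry_norm_poly.
Qed.

Lemma monomial_mul (R : comAlgType rat) (g h : 'M[gauss R]_n) I J :
  \prod_t (g *m h) (I t) (J t) =
  \sum_(K : {ffun 'I_n -> 'I_n}) (\prod_t g (I t) (K t)) * \prod_t h (K t) (J t).
Proof.
under eq_bigr => t _ do rewrite mxE.
by rewrite bigA_distr_bigA; apply: eq_bigr => K _; rewrite big_split.
Qed.
End Monomials.
End RegularFunctions.

Section GroupLaw.
Variables (n : nat) (q : {hermitian 'rV[L]_n for false & sigma}).
Hypotheses (q_nondeg : nondegenerate q) (n_gt0 : (0 < n)%N).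
Implicit Types I J K : {ffun 'I_n -> 'I_n}.
Notation T := (monomial q_nondeg n_gt0).

Lemma is_adjoint_mul_sum (A : comPzRingType) (x1 x2 x12 : adjoint_group q A)
    (X : finType) (f : adjoint_ring q) (a b : X -> adjoint_ring q) :
  is_adjoint_mul x1 x2 x12 ->
  (forall (R : comAlgType rat) (g h : 'M[gauss R]_n), SU q g -> SU q h ->
     evalSU (g *m h) f = \sum_k evalSU g (a k) * evalSU h (b k)) ->
  x12 f = \sum_k x1 (a k) * x2 (b k).
Proof.
move=> x12P fP; rewrite (x12P f #|X| (a \o enum_val) (b \o enum_val)) => [|R g h gU hU].
  by rewrite [RHS](reindex _ (onW_bij _ (@enum_val_bij X))).
by rewrite fP // (reindex _ (onW_bij _ (@enum_val_bij X))).
Qed.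

Lemma monomial_evalM (R : comAlgType rat) (g h : 'M[gauss R]_n) I J :
  SU q g -> SU q h ->
  Gauss (evalSU (g *m h) (gre (T I J))) (evalSU (g *m h) (gim (T I J))) =
  \sum_(K : {ffun 'I_n -> 'I_n})
    Gauss (evalSU g (gre (T I K))) (evalSU g (gim (T I K))) *
    Gauss (evalSU h (gre (T K J))) (evalSU h (gim (T K J))).
Proof.
move=> gU hU; have ghU := SUM gU hU.
transitivity (gauss_map (adjoint_eval ghU) (T I J)) => //.
rewrite monomialE monomial_mul; apply: eq_bigr => K _.
by rewrite -(monomialE q_nondeg n_gt0 gU) -(monomialE q_nondeg n_gt0 hU).
Qed.

Lemma gre_sum (R : comNzRingType) (X : finType) (F : X -> gauss R) :
  gre (\sum_k F k) = \sum_k gre (F k).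
Proof. exact: (big_morph (@gre R) (fun x y => erefl) erefl). Qed.
Lemma gim_sum (R : comNzRingType) (X : finType) (F : X -> gauss R) :
  gim (\sum_k F k) = \sum_k gim (F k).
Proof. exact: (big_morph (@gim R) (fun x y => erefl) erefl). Qed.

(** The monomials form a matrix representation of G. *)
Lemma adjoint_mul_monomial (A : comNzRingType) (x1 x2 x12 : adjoint_group q A) I J :
  is_adjoint_mul x1 x2 x12 ->
  gauss_map x12 (T I J) =
  \sum_(K : {ffun 'I_n -> 'I_n}) gauss_map x1 (T I K) * gauss_map x2 (T K J).
Proof.
move=> x12P.
pose ix := ({ffun 'I_n -> 'I_n} + {ffun 'I_n -> 'I_n})%type.
have reE := @is_adjoint_mul_sum _ x1 x2 x12 ix (gre (T I J))
  (fun k => match k with inl K => gre (T I K) | inr K => - gim (T I K) end)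
  (fun k => match k with inl K => gre (T K J) | inr K => gim (T K J) end) x12P.
have imE := @is_adjoint_mul_sum _ x1 x2 x12 ix (gim (T I J))
  (fun k => match k with inl K => gre (T I K) | inr K => gim (T I K) end)
  (fun k => match k with inl K => gim (T K J) | inr K => gre (T K J) end) x12P.
rewrite [RHS](_ : _ = Gauss (gre (\sum_(K : {ffun 'I_n -> 'I_n})
    gauss_map x1 (T I K) * gauss_map x2 (T K J)))
  (gim (\sum_(K : {ffun 'I_n -> 'I_n}) gauss_map x1 (T I K) * gauss_map x2 (T K J))));
  last by case: (\sum_(_ | _) _).
rewrite gre_sum gim_sum; congr Gauss.
  rewrite /= reE => [|R g h gU hU].
    rewrite big_sumType /= -big_split; apply: eq_bigr => K _.
    by rewrite /= rmorphN mulNr.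
  have := congr1 (@gre R) (monomial_evalM I J gU hU); rewrite gre_sum [LHS]/= => ->.
  rewrite big_sumType /= -big_split; apply: eq_bigr => K _.
  have evN (F : adjoint_ring q) : evalSU g (- F : adjoint_ring q) = - evalSU g F.
    exact: (rmorphN (adjoint_eval gU) F).
  by rewrite /= -mulNr; congr (_ + _ * _); exact: esym (evN (gim (T I K))).
rewrite /= imE => [|R g h gU hU].
  by rewrite big_sumType /= -big_split; apply: eq_bigr.
have := congr1 (@gim R) (monomial_evalM I J gU hU); rewrite gim_sum [LHS]/= => ->.
by rewrite big_sumType /= -big_split; apply: eq_bigr.
Qed.

Lemma prod_diagonal (R : comNzRingType) (A : 'M[R]_n) I K :
  (forall i j, i != j -> A i j = 0) ->
  \prod_t A (I t) (K t) = (\prod_t A (I t) (I t)) * (I == K)%:R.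
Proof.
move=> Adiag; case: eqVneq => [->|IK]; first by rewrite mulr1.
rewrite mulr0; case: (pickP (fun t => I t != K t)) => [t It|IK0].
  by rewrite (bigD1 t) //= Adiag // mul0r.
by case/eqP: IK; apply/ffunP => t; apply/eqP; move/negbFE: (IK0 t).
Qed.

Definition adjoint_one : adjoint_group q rat :=
  (adjoint_eval (SU1 q rat^o) : {rmorphism adjoint_ring q -> rat^o}).

Lemma adjoint_one_monomial I J : gauss_map adjoint_one (T I J) = (I == J)%:R.
Proof.
rewrite [LHS](monomialE q_nondeg n_gt0 (SU1 q rat^o)) prod_diagonal.
  by rewrite big1 ?mul1r // => t _; rewrite mxE eqxx.
by move=> i j /negPf ij; rewrite mxE ij.
Qed.

Lemma adjoint_const_mem (r : rat) :
  (\pi_(SU_ring q) (mpoly.mpolyC _ r))%qT \in @adjoint_pred n q.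
Proof. by apply: adjoint_memP => R g z gU zZ; rewrite /eval_poly !mpoly.mmapC. Qed.

Definition adjoint_const (r : rat) : adjoint_ring q := AdjointFun (adjoint_const_mem r).

Lemma adjoint_constE (R : comAlgType rat) (g : 'M[gauss R]_n) (gU : SU q g) r :
  adjoint_eval gU (adjoint_const r) = r%:A.
Proof. by rewrite /adjoint_eval /= evalSU_pi // /eval_poly mpoly.mmapC. Qed.

Lemma adjoint_const_zmod : zmod_morphism adjoint_const.
Proof.
move=> r s; apply: adjoint_ext => R g gU; rewrite rmorphB /= !adjoint_constE.
by rewrite scalerBl.
Qed.
HB.instance Definition _ := GRing.isZmodMorphism.Build rat (adjoint_ring q)
  adjoint_const adjoint_const_zmod.
Lemma adjoint_const_monoid : monoid_morphism adjoint_const.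
Proof.
split=> [|r s]; apply: adjoint_ext => R g gU; rewrite ?rmorph1 ?rmorphM /= !adjoint_constE.
  by rewrite scale1r.
exact: (rmorphM (in_alg R)).
Qed.
HB.instance Definition _ := GRing.isMonoidMorphism.Build rat (adjoint_ring q)
  adjoint_const adjoint_const_monoid.

(** The comultiplication identity at h = 1 writes f as a combination of the [a i]
    with rational coefficients. *)
Lemma is_adjoint_mul_one (A : comPzRingType) (iota : {rmorphism rat -> A})
    (x e : adjoint_group q A) :
  (forall f, e f = iota (adjoint_one f)) -> is_adjoint_mul x e x.
Proof.
move=> eE f m a b fP.
have -> : f = \sum_i a i * adjoint_const (adjoint_one (b i)).
  apply: adjoint_ext => R g gU; rewrite rmorph_sum -[LHS]/(evalSU g f).
  have := fP R g 1%:M gU (SU1 q R); rewrite mulmx1 => ->.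
  apply: eq_bigr => i _; rewrite rmorphM /= adjoint_constE; congr (_ * _).
  have -> : (1%:M : 'M[gauss R]_n) = map_mx (gauss_map (in_alg R : rat^o -> R)) 1%:M.
    by rewrite map_mx1.
  by rewrite (@evalSU_natural n q rat^o R (in_alg R)).
rewrite rmorph_sum; apply: eq_bigr => i _; rewrite rmorphM eE; congr (_ * _).
exact: (rat_rmorphism_unique (x \o adjoint_const) iota).
Qed.
End GroupLaw.

(** * Adjoining a root *)

Section RootExtension.
Variables (A : comNzRingType) (n : nat) (a : A).
Hypothesis n_gt0 : (0 < n)%N.

Definition root_ext := {poly %/ ('X^n - a%:P : {poly A})}.
HB.instance Definition _ := GRing.ComNzRing.on root_ext.
Definition root_const : A -> root_ext := qpolyC ('X^n - a%:P).
HB.instance Definition _ := GRing.RMorphism.on root_const.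
Definition root_in : {poly A} -> root_ext := in_qpoly ('X^n - a%:P).
HB.instance Definition _ := GRing.RMorphism.on root_in.
Definition root_gen : root_ext := root_in 'X.
Definition root_coef (k : nat) (y : root_ext) : A := (y : {poly A})`_k.

Lemma root_modulus : mk_monic ('X^n - a%:P : {poly A}) = 'X^n - a%:P.
Proof. by rewrite /mk_monic size_XnsubC // monicXnsubC // ltnS n_gt0. Qed.

Lemma root_size (y : root_ext) : (size (y : {poly A}) <= n)%N.
Proof.
have := size_mk_monic y; have : size (mk_monic ('X^n - a%:P : {poly A})) = n.+1.
  by rewrite root_modulus size_XnsubC.
by move=> sE lt; rewrite -ltnS -sE.
Qed.

Lemma root_inK (P : {poly A}) : (size P <= n)%N -> root_in P = P :> {poly A}.
Proof. by move=> Pn; apply: in_qpoly_small; rewrite root_modulus size_XnsubC. Qed.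

Lemma root_constE c : root_const c = root_in c%:P.
Proof.
apply: val_inj; rewrite [RHS]root_inK; first exact: qpolyCE.
exact: leq_trans (size_polyC_leq1 c) n_gt0.
Qed.

Lemma root_genX : root_gen ^+ n = root_const a.
Proof.
have /eqP : root_in ('X^n - a%:P) = 0.
  apply: val_inj; transitivity (0 : {poly A}); last by [].
  rewrite -[LHS]/(Pdiv.CommonRing.rmodp ('X^n - a%:P) (mk_monic ('X^n - a%:P))).
  by rewrite root_modulus Pdiv.RingMonic.rmodpp // monicXnsubC.
by rewrite rmorphB subr_eq0 rmorphXn root_constE => /eqP.
Qed.

Lemma root_expand y : y = \sum_(k < n) root_const (root_coef k y) * root_gen ^+ k.
Proof.
have yE : y = root_in (y : {poly A}) by apply: val_inj; rewrite [RHS]root_inK ?root_size.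
have PE : (y : {poly A}) = \poly_(k < n) root_coef k y.
  apply/polyP => k; rewrite coef_poly; case: ltnP => // nk.
  by rewrite nth_default // (leq_trans (root_size y)).
rewrite [LHS]yE [X in root_in X]PE poly_def rmorph_sum; apply: eq_bigr => k _.
by rewrite -mul_polyC rmorphM rmorphXn root_constE.
Qed.

Lemma root_coef_sum (c : 'I_n -> A) (k : 'I_n) :
  root_coef k (\sum_(i < n) root_const (c i) * root_gen ^+ i) = c k.
Proof.
have -> : \sum_(i < n) root_const (c i) * root_gen ^+ i = root_in (\sum_(i < n) c i *: 'X^i).
  rewrite rmorph_sum; apply: eq_bigr => i _.
  by rewrite -mul_polyC rmorphM rmorphXn root_constE.
have -> : \sum_(i < n) c i *: 'X^i = \poly_(i < n) (if insub i is Some j then c j else 0).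
  by rewrite poly_def; apply: eq_bigr => i _; rewrite valK.
by rewrite /root_coef root_inK ?size_poly // coef_poly ltn_ord valK.
Qed.

Lemma root_coef_const c : root_coef 0 (root_const c) = c.
Proof.
have cE : (root_const c : {poly A}) = c%:P := qpolyCE _ c.
by rewrite /root_coef cE coefC.
Qed.

Section Lift.
Variables (C : comNzRingType) (h : {rmorphism A -> C}) (c : C).
Hypothesis cn : c ^+ n = h a.
Definition root_lift of (0 < n)%N & c ^+ n = h a :=
  fun y : root_ext => (map_poly h (y : {poly A})).[c].

Lemma root_lift_in (P : {poly A}) : root_lift n_gt0 cn (root_in P) = (map_poly h P).[c].
Proof.
have mon : 'X^n - a%:P \is monic by apply: monicXnsubC.
rewrite [in RHS](Pdiv.RingMonic.rdivp_eq mon P) rmorphD rmorphM hornerD hornerM /=.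
rewrite /root_lift /root_in /= root_modulus.
rewrite [(map_poly h ('X^n - _)).[c]](_ : _ = 0) ?mulr0 ?add0r //.
by rewrite rmorphB /= map_polyXn map_polyC !hornerE cn subrr.
Qed.

Lemma root_lift_zmod : zmod_morphism (root_lift n_gt0 cn).
Proof.
move=> x y; rewrite /root_lift.
have -> : ((x - y : root_ext) : {poly A}) = (x : {poly A}) - (y : {poly A}) by [].
by rewrite rmorphB hornerD hornerN.
Qed.
HB.instance Definition _ :=
  GRing.isZmodMorphism.Build root_ext C (root_lift n_gt0 cn) root_lift_zmod.
Lemma root_lift_monoid : monoid_morphism (root_lift n_gt0 cn).
Proof.
split=> [|x y].
  by rewrite -(rmorph1 root_in) root_lift_in rmorph1 hornerC.
rewrite -[x * y]/(root_in ((x : {poly A}) * (y : {poly A}))) root_lift_in.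
by rewrite rmorphM hornerM.
Qed.
HB.instance Definition _ :=
  GRing.isMonoidMorphism.Build root_ext C (root_lift n_gt0 cn) root_lift_monoid.

Lemma root_lift_const x : root_lift n_gt0 cn (root_const x) = h x.
Proof. by rewrite root_constE root_lift_in map_polyC hornerC. Qed.
Lemma root_lift_gen : root_lift n_gt0 cn root_gen = c.
Proof. by rewrite root_lift_in map_polyX hornerX. Qed.
End Lift.
End RootExtension.

(** * Projective points *)

(** For morphisms that are constructed inside a proof. *)
Definition as_rmorphism (R S : pzRingType) (f : R -> S)
  of zmod_morphism f & monoid_morphism f := f.
HB.instance Definition _ (R S : pzRingType) (f : R -> S) (fz : zmod_morphism f)
  (fm : monoid_morphism f) := GRing.isZmodMorphism.Build R S (as_rmorphism fz fm) fz.
HB.instance Definition _ (R S : pzRingType) (f : R -> S) (fz : zmod_morphism f)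
  (fm : monoid_morphism f) := GRing.isMonoidMorphism.Build R S (as_rmorphism fz fm) fm.

Lemma gauss_eval_natural (R R' : comNzRingType) (h : {rmorphism R -> R'}) (J : R)
    (J' : R') (JJ : J ^+ 2 = -1) (JJ' : J' ^+ 2 = -1) (z : gauss R) :
  h J = J' -> gauss_eval JJ' (gauss_map h z) = h (gauss_eval JJ z).
Proof. by move=> hJ; rewrite /gauss_eval /= rmorphD rmorphM hJ. Qed.

Lemma SU_map (n : nat) (q : {hermitian 'rV[L]_n for false & sigma})
    (R R' : comAlgType rat) (h : {rmorphism R -> R'}) (g : 'M[gauss R]_n) :
  SU q g -> SU q (map_mx (gauss_map h) g).
Proof.
move=> [gU g1]; have gramE : gram q R' = map_mx (gauss_map h) (gram q R).
  apply/matrixP => i j; rewrite !mxE.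
  by congr Gauss; apply: (rat_rmorphism_unique (in_alg R') (h \o in_alg R)).
split; last by rewrite det_map_mx g1 rmorph1.
have conjE : map_mx (@gauss_conj R') (map_mx (gauss_map h) g) =
    map_mx (gauss_map h) (map_mx (@gauss_conj R) g).
  by apply/matrixP => i j; rewrite !mxE gauss_map_conj.
by rewrite conjE gramE map_trmx -[in RHS]gU !map_mxM.
Qed.

Section ProjectivePoint.
Variables (n : nat) (q : {hermitian 'rV[L]_n for false & sigma}).
Hypotheses (q_nondeg : nondegenerate q) (n_gt0 : (0 < n)%N).
Variables (F : comNzRingType) (iota : {rmorphism rat -> F}) (J : F) (JJ : J ^+ 2 = -1).
Variables (A : 'M[F]_n) (u : F).
Hypothesis Au : u * \det A = 1.

Let R0 : comNzRingType := root_ext n u.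
Let R : comAlgType rat := under_rat (@root_const F n u \o iota).
Let tau : R := root_gen n u.
Let toR : {rmorphism F -> R} := @root_const F n u.
Let JR : R := toR J.
Let JJR : JR ^+ 2 = -1. Proof. by rewrite -rmorphXn JJ rmorphN1. Qed.
Let tauX : tau ^+ n = toR u. Proof. exact: root_genX. Qed.

Let R' : comAlgType rat := under_rat (@root_const R n 1 \o (toR \o iota)).
Let h1 : {rmorphism R -> R'} := @root_const R n 1.
Let s : R' := root_gen n (1 : R).
Let sX : s ^+ n = 1. Proof. by rewrite -(rmorph1 h1); apply: root_genX. Qed.
Let cX : (h1 tau * s) ^+ n = (h1 \o toR) u.
Proof. by rewrite exprMn sX mulr1 -rmorphXn tauX. Qed.
Let h2 : {rmorphism R -> R'} := root_lift n_gt0 cX.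
Let JR' : R' := h1 JR.
Let JJR' : JR' ^+ 2 = -1. Proof. by rewrite -rmorphXn JJR rmorphN1. Qed.

Let h2_const x : h2 (toR x) = h1 (toR x).
Proof. exact: root_lift_const. Qed.
Let h2_tau : h2 tau = h1 tau * s.
Proof. exact: root_lift_gen. Qed.

(** h2 multiplies tau by the n-th root of unity s.  As 1, s, .., s^(n-1) are
    independent over R, comparing the coefficients of s^0 shows that only the
    constants are fixed. *)
Lemma fixed_root_const (y : R) : h1 y = h2 y -> y = toR (root_coef 0 y).
Proof.
have yE : y = \sum_(k < n) toR (root_coef k y) * tau ^+ k by apply: root_expand.
have h2y : h2 y = \sum_(k < n) h1 (toR (root_coef k y) * tau ^+ k) * s ^+ k.
  rewrite {1}yE rmorph_sum; apply: eq_bigr => k _.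
  by rewrite !rmorphM h2_const !rmorphXn /= h2_tau exprMn mulrA.
rewrite h2y => /(congr1 (root_coef 0)).
have -> : root_coef 0 (h1 y) = y by apply: root_coef_const.
move=> {1}->.
have := @root_coef_sum R n 1 n_gt0 (fun k : 'I_n => toR (root_coef k y) * tau ^+ k) (Ordinal n_gt0).
by rewrite /= expr0 mulr1.
Qed.

(** The point of PGL_n(F) given by an invertible matrix A.  Over F[tau], with
    tau^n = u the inverse of det A, the matrix tau A has determinant 1 and so
    comes from a point of SU_n(q).  Multiplying tau by a root of unity s changes
    that point by a central scalar, which a function on G does not see; so the
    values of functions on G are fixed by tau |-> s tau, and lie in F. *)
Lemma adjoint_point : exists x : adjoint_group q F, forall I K : {ffun 'I_n -> 'I_n},
  gauss_eval JJ (gauss_map x (monomial q_nondeg n_gt0 I K)) = u * \prod_t A (I t) (K t).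
Proof.
have detA : \det (tau *: map_mx toR A) = 1.
  by rewrite detZ det_map_mx tauX -rmorphM Au rmorph1.
have [g gU gE] := SU_split q_nondeg JJR detA.
pose s' := s ^+ n.-1; have ss' : s * s' = 1 by rewrite -exprS prednK.
pose zeta := gauss_split JR' s s'.
have z1 : zeta * gauss_conj zeta = 1.
  apply: (gauss_eval_inj (JJ := JJR')); rewrite !rmorphM !rmorph1 /= ?gauss_conjK.
    by rewrite (gauss_evalK JJR') (gauss_eval_conjK JJR').
  by rewrite (gauss_evalK JJR') (gauss_eval_conjK JJR') mulrC.
have zn : zeta ^+ n = 1.
  apply: (gauss_eval_inj (JJ := JJR')); rewrite !rmorphXn !rmorph1 /=.
    by rewrite (gauss_evalK JJR').
  by rewrite (gauss_eval_conjK JJR') /s' -exprM mulnC exprM sX expr1n.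
have zZ := SU_scalar q z1 zn.
have g1U := SU_map h1 gU; have g2U := SU_map h2 gU.
have g12 : map_mx (gauss_map h1) g *m zeta%:M = map_mx (gauss_map h2) g.
  have natE (h : {rmorphism R -> R'}) : h JR = JR' ->
      map_mx (gauss_eval JJR') (map_mx (gauss_map h) g) = map_mx h (tau *: map_mx toR A).
    move=> hJ; rewrite -gE; apply/matrixP => i j; rewrite !mxE.
    exact: gauss_eval_natural.
  apply: (@SU_split_inj n q q_nondeg R' JR' JJR' _ _ (SUM g1U zZ.1) g2U).
  rewrite natE; last exact: h2_const.
  rewrite map_mxM natE // map_scalar_mx /= (gauss_evalK JJR') mul_mx_scalar.
  apply/matrixP => i j; rewrite !mxE !rmorphM /= h2_tau h2_const.
  by rewrite [s * _]mulrC mulrAC.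
pose ev := adjoint_eval gU.
have evE f : ev f = toR (root_coef 0 (ev f)).
  apply: fixed_root_const; have /asboolP fP := valP f.
  have e1 := evalSU_natural h1 g (val f); have e2 := evalSU_natural h2 g (val f).
  have e3 := fP _ _ _ g1U zZ; have e4 := congr1 (fun k => evalSU k (val f)) g12.
  exact: etrans (esym e1) (etrans (esym e3) (etrans e4 e2)).
have toR_inj : injective toR.
  move=> a b ab; rewrite -[a](@root_coef_const F n u) -[b](@root_coef_const F n u).
  by rewrite -[root_const _ _ a]/(toR a) ab.
have fz : zmod_morphism (fun f => root_coef 0 (ev f)).
  move=> f f'; apply: toR_inj.
  have e1 : ev (f - f') = ev f - ev f' := rmorphB (adjoint_eval gU) f f'.
  have e2 := rmorphB toR (root_coef 0 (ev f)) (root_coef 0 (ev f')).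
  have e3 : ev f - ev f' = toR (root_coef 0 (ev f)) - toR (root_coef 0 (ev f')).
    by congr (_ - _); apply: evE.
  exact: etrans (esym (evE (f - f'))) (etrans e1 (etrans e3 (esym e2))).
have fm : monoid_morphism (fun f => root_coef 0 (ev f)).
  split=> [|f f']; apply: toR_inj.
    exact: etrans (esym (evE 1)) (etrans (rmorph1 (adjoint_eval gU)) (esym (rmorph1 toR))).
  have e1 : ev (f * f') = ev f * ev f' := rmorphM (adjoint_eval gU) f f'.
  have e2 := rmorphM toR (root_coef 0 (ev f)) (root_coef 0 (ev f')).
  have e3 : ev f * ev f' = toR (root_coef 0 (ev f)) * toR (root_coef 0 (ev f')).
    by congr (_ * _); apply: evE.
  exact: etrans (esym (evE (f * f'))) (etrans e1 (etrans e3 (esym e2))).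
exists (as_rmorphism fz fm) => I K; apply: toR_inj.
rewrite -(gauss_eval_natural _ JJR) // rmorphM rmorph_prod.
have -> : gauss_map toR (gauss_map (as_rmorphism fz fm) (monomial q_nondeg n_gt0 I K)) =
    gauss_map ev (monomial q_nondeg n_gt0 I K).
  by congr Gauss; rewrite [RHS]evE.
rewrite monomialE rmorph_prod -tauX /=.
have -> : tau ^+ n = \prod_(t < n) tau by rewrite prodr_const card_ord.
rewrite -big_split; apply: eq_bigr => t _.
by move/matrixP/(_ (I t) (K t)): gE; rewrite !mxE.
Qed.
End ProjectivePoint.

(** * Approximation by rational points *)

Section AdeleAt.
Variables (S : set place) (v : place_off S).
Definition adele_at (x : adele S) : Qp v := x v.
Lemma adele_at_zmod : zmod_morphism adele_at. Proof. by []. Qed.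
HB.instance Definition _ := GRing.isZmodMorphism.Build (adele S) (Qp v) adele_at adele_at_zmod.
Lemma adele_at_monoid : monoid_morphism adele_at. Proof. by []. Qed.
HB.instance Definition _ := GRing.isMonoidMorphism.Build (adele S) (Qp v) adele_at adele_at_monoid.
End AdeleAt.

Section Approximation.
Variables (n : nat) (q : {hermitian 'rV[L]_n for false & sigma}) (S : set place).

Lemma open_Qp_ball (p : prime_number) k (a : Qp p) : open [set y | Qp_ball k (y - a)].
Proof.
move=> y /= ya; exists k => z zy /=.
by rewrite -(subrK y z) -addrA; apply: Qp_ballD.
Qed.

Lemma adele_nbhs (b : adele S) (w : place_off S) :
  nbhs b [set y : adele S | Qp_ball 1 (y w - b w) /\ forall v, padic_int (y v - b v)].
Proof.
pose U (v : place_off S) : set (Qp v) :=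
  [set y | Qp_ball (if pselect (v = w) then 1 else 0) (y - b v)].
rewrite nbhsE; exists (adele_box U); last first.
  move=> y yU; split; first by have := yU w; rewrite /U /=; case: pselect.
  by move=> v; apply: Qp_ball_le (yU v); case: pselect.
split; last by move=> v; rewrite /U /= subrr; apply: Qp_ball0.
move=> y yU; exists U; split=> //; first by move=> v; apply: open_Qp_ball.
apply: (@sub_finite_set _ _ ([set v | ~ padic_int (b v)] `|` [set w])).
  move=> v /= UN; apply: contrapT => /not_orP[/contrapT bv vw]; apply: UN.
  rewrite /U; case: pselect => [/vw//|ne]; apply/seteqP; split=> z /= zb.
    by rewrite -(subrK (b v) z); apply: Qp_ballD.
  by apply: Qp_ballD => //; apply: Qp_ballN.
by rewrite finite_setU; split; [apply: adele_valP | apply: finite_set1].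
Qed.

Lemma eval_continuous (f : adjoint_ring q) :
  continuous (fun x : adelic_points q S => x f : adele S).
Proof.
move=> x; pose e (y : adelic_points q S) : {ptws adjoint_ring q -> adele S} := y.
apply: (@continuous_comp _ _ _ e (proj f)); first exact: initial_continuous.
exact: proj_continuous.
Qed.

(** Evaluation of each [F i] is continuous, so finitely many conditions of this
    kind define a neighbourhood of h. *)
Lemma closure_rational_approx (X : finType) (F : X -> adjoint_ring q)
    (h : adelic_points q S) (w : place_off S) :
  closure (rational_points q S) h ->
  exists x : adjoint_group q rat, forall i : X,
    Qp_ball 1 (Qp_of_rat w (x (F i)) - h (F i) w) /\
    forall v : place_off S, padic_int (Qp_of_rat v (x (F i)) - h (F i) v).
Proof.
move=> hcl.
pose W (i : X) : set (adelic_points q S) := (fun x : adelic_points q S => x (F i) : adele S) @^-1`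
  [set y : adele S | Qp_ball 1 (y w - h (F i) w) /\ forall v, padic_int (y v - h (F i) v)].
have Wh : \forall y \near h, forall i, W i y.
  apply: (@filter_forall _ _ W (nbhs h) _) => i.
  exact: (@eval_continuous (F i) h _ (adele_nbhs (h (F i)) w)).
have [y [[x _ <-] yW]] := hcl _ Wh.
by exists x => i; have := yW i.
Qed.
End Approximation.

(** * Rational points with integral monomials *)

Section RationalPoints.
Variables (n : nat) (q : {hermitian 'rV[L]_n for false & sigma}).
Hypotheses (q_nondeg : nondegenerate q) (n_gt0 : (0 < n)%N).
Implicit Types I K : {ffun 'I_n -> 'I_n}.
Notation T := (monomial q_nondeg n_gt0).

(** Let c_ij be the n-th power of the entry (i, j), as a monomial.  Since the
    determinant is 1 and all monomials are integral, the product m of the entries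
    (t, s t) has valuation 0 for some permutation s.  Its n-th power is the
    product of the c_tj with j = s t, so these have valuation 0 as well.  Finally
    c_ij * c_ii^(n-1) with j = s i is the n-th power of a monomial, so n divides
    n - 1 times the valuation of c_ii. *)
Lemma monomial_val_dvd (p : prime_number) (J : Qp p) (JJ : J ^+ 2 = -1)
    (x : adjoint_group q rat) (i : 'I_n) :
  (forall I K, padic_int (padic_place JJ (gauss_map x (T I K)))) ->
  gauss_map x (T (ffconst i) (ffconst i)) != 0 ->
  exists k : int, has_val (padic_place JJ (gauss_map x (T (ffconst i) (ffconst i)))) (k *+ n).
Proof.
move=> xint c0; pose phi : {rmorphism L -> Qp p} := padic_place JJ.
pose t I K : Qp p := phi (gauss_map x (T I K)).
pose c a b := t (ffconst a) (ffconst b).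
have tX I K : t I K ^+ n = \prod_s c (I s) (K s).
  have := congr1 (phi \o gauss_map x) (monomialX q_nondeg n_gt0 I K).
  rewrite rmorphXn rmorph_prod => e; exact: e.
have tdet : \sum_(s : 'S_n) (-1) ^+ s * t (finfun id) (finfun s) = 1.
  have := congr1 (phi \o gauss_map x) (monomial_det q_nondeg n_gt0).
  rewrite rmorph1 rmorph_sum => e; apply: etrans e; apply: eq_bigr => s _.
  by rewrite rmorphM rmorph_sign.
have [s sN] : exists s : 'S_n, ~ Qp_ball 1 (t (finfun id) (finfun s)).
  apply: contrapT => /forallNP sP.
  have : Qp_ball 1 (1 : Qp p).
    rewrite -tdet; elim/big_ind: _ => [|a b|s _]; [exact: Qp_ball0|exact: Qp_ballD|].
    have := contrapT (sP s); case: (odd_perm s); rewrite ?expr1 ?expr0 ?mulN1r ?mul1r //= => h.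
    exact: Qp_ballN.
  have := @Qp_ball_int1 p 1; rewrite /= => -[h _] /h.
  by rewrite dvdz1 /= gtn_eqF ?prime_gt1 ?prime_valP.
set m := t _ _ in sN.
have m0 : m != 0 by apply/eqP => m0; apply: sN; rewrite m0; apply: Qp_ball0.
have [k kP] := has_val_exists m0.
have k0 : k = 0.
  have := (has_val_ge 0 kP).1 (xint _ _).
  have : ~~ (1 <= k) by apply/negP => k1; apply: sN; apply/(has_val_ge _ kP).
  lia.
rewrite {}k0 in kP.
pose j := s i.
have cj : has_val (c i j) 0.
  have := has_valX n kP; rewrite tX (bigD1 i) //= !ffunE mul0rn -/j => h.
  set r := \prod_(_ | _) _ in h.
  have [] := h; rewrite mulf_eq0 negb_or => /andP[c0' r0] _ _.
  have [a aP] := has_val_exists c0'; have [b bP] := has_val_exists r0.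
  have a0 : 0 <= a by apply/(has_val_ge _ aP); apply: xint.
  have b0 : 0 <= b by apply/(has_val_ge _ bP); apply: padic_int_prod => ? _; apply: xint.
  have := has_val_uniq (has_valM aP bP) h => ab.
  by have <- : a = 0 by lia.
have cii0 : c i i != 0 by rewrite fmorph_eq0.
have [a aP] := has_val_exists cii0.
(* One factor (i, j) and n - 1 factors (i, i). *)
pose K : {ffun 'I_n -> 'I_n} := [ffun s => if s == i then j else i].
have yX : t (ffconst i) K ^+ n = c i j * c i i ^+ n.-1.
  rewrite tX (bigD1 i) //= !ffunE eqxx; congr (_ * _).
  rewrite (eq_bigr (fun=> c i i)) => [|s' /negPf si]; last by rewrite !ffunE si.
  by rewrite prodr_const cardC1 card_ord.
have yX0 := has_valM cj (has_valX n.-1 aP); rewrite -yX add0r in yX0.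
have y0 : t (ffconst i) K != 0.
  by have [] := yX0; rewrite expf_eq0 n_gt0 /=.
have [b bP] := has_val_exists y0.
have := has_val_uniq yX0 (has_valX n bP) => ab.
exists (a - b); suff -> : (a - b) *+ n = a by [].
by rewrite mulrnBl -ab -[X in _ *+ X - _](prednK n_gt0) mulrS addrK.
Qed.

(** The valuations are multiples of n at the split places, and the norm is an n-th
    power. *)
Lemma rational_monomial_power (x : adjoint_group q rat) (i : 'I_n) :
  odd n ->
  (forall p : prime_number, (p = 1 %[mod 4])%N -> exists (J : Qp p) (JJ : J ^+ 2 = -1),
     padic_int J /\ forall I K, padic_int (padic_place JJ (gauss_map x (T I K)))) ->
  gauss_map x (T (ffconst i) (ffconst i)) != 0 ->
  exists w : L, gauss_map x (T (ffconst i) (ffconst i)) = w ^+ n.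
Proof.
move=> n_odd xint c0; apply: (@gauss_rat_power n _ (x (entry_norm q_nondeg n_gt0 i i))) => //.
  rewrite -rmorphXn -monomial_norm /gauss_norm rmorphD !rmorphXn //.
move=> p p1; have [J [JJ [J0 xP]]] := xint p p1; exists J, JJ.
by have [k kP] := monomial_val_dvd xP c0; exists k.
Qed.
End RationalPoints.

(** * Cosets *)

Section AdelicPointsOfG.
Variables (n : nat) (q : {hermitian 'rV[L]_n for false & sigma}).
Hypotheses (q_nondeg : nondegenerate q) (n_gt0 : (0 < n)%N).
Implicit Types I K : {ffun 'I_n -> 'I_n}.
Notation T := (monomial q_nondeg n_gt0).
Variables (S : set place) (J : forall v : place_off S, Qp v).
Hypothesis JJ : forall v, J v ^+ 2 = -1.
Hypothesis J0 : forall v, padic_int (J v).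
Variables i0 i1 : 'I_n.
Hypothesis i01 : i0 != i1.

Definition local_point (v : place_off S) (x : adjoint_group q (adele S)) :
  adjoint_group q (Qp v) := @adele_at S v \o x.

(** At v, the point x acts on the n-th tensor power by a diagonal matrix with unit
    entries. *)
Definition diagonal_at (v : place_off S) (x : adjoint_group q (Qp v))
    (d : {ffun 'I_n -> 'I_n} -> Qp v) :=
  (forall I, has_val (d I) 0) /\
  forall I K, gauss_eval (JJ v) (gauss_map x (T I K)) = d I * (I == K)%:R.

(** The point given by the diagonal matrix with u^-1 at i1 and 1 elsewhere: the
    n-th power of the entry at i0, divided by the determinant, is u. *)
Lemma diagonal_point (v : place_off S) (u : int) : ~~ (v %| u)%Z ->
  exists (x : adjoint_group q (Qp v)) d, diagonal_at x d /\ d (ffconst i0) = u%:~R.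
Proof.
move=> vu; have uP := has_val0_int vu; have [u0 _ _] := uP.
pose a (i : 'I_n) : Qp v := if i == i1 then u%:~R^-1 else 1.
have aP i : has_val (a i) 0.
  rewrite /a; case: eqP => _; last exact: has_val1.
  by have := has_valV uP; rewrite oppr0.
pose A : 'M[Qp v]_n := diag_mx (\row_i a i).
have detA : u%:~R * \det A = 1.
  rewrite det_diag (bigD1 i1) //= big1 => [|i /negPf i_i1]; last by rewrite mxE /a i_i1.
  by rewrite mxE /a eqxx mulr1 mulfV.
have [x xP] := adjoint_point q_nondeg n_gt0 (Qp_of_rat v) (JJ v) detA.
exists x, (fun I => u%:~R * \prod_t a (I t)); split; last first.
  rewrite big1 ?mulr1 // => t _.
  by rewrite /a ffunE (negPf i01).
split=> [I|I K].
  rewrite -[X in has_val _ X]addr0; apply: has_valM => //.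
  elim/big_ind: _ => [|y z yP zP|t _]; [exact: has_val1| |exact: aP].
  by rewrite -[X in has_val _ X]addr0; apply: has_valM.
rewrite xP prod_diagonal => [|i j /negPf ij]; last by rewrite !mxE ij.
by rewrite mulrA; congr (_ * _ * _); apply: eq_bigr => t _; rewrite !mxE eqxx.
Qed.

Lemma one_diagonal (v : place_off S) (x : adjoint_group q (Qp v)) :
  (forall f, x f = Qp_of_rat v (adjoint_one q f)) -> diagonal_at x (fun=> 1).
Proof.
move=> xE; split=> [_|I K]; first exact: has_val1.
have -> : gauss_map x (T I K) = gauss_map (Qp_of_rat v) (gauss_map (adjoint_one q) (T I K)).
  by congr Gauss; rewrite /= xE.
by rewrite adjoint_one_monomial mul1r !rmorph_nat.
Qed.

Lemma supported_point (w : place_off S) (u : int) : ~~ (w %| u)%Z ->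
  exists (x : adjoint_group q (adele S)) (d : forall v : place_off S, {ffun 'I_n -> 'I_n} -> Qp v),
    [/\ forall v, diagonal_at (local_point v x) (d v),
        d w (ffconst i0) = u%:~R & forall v, v <> w -> d v = fun=> 1].
Proof.
move=> wu.
have yP (v : place_off S) : exists (x : adjoint_group q (Qp v)) d,
    [/\ diagonal_at x d, v = w -> d (ffconst i0) = u%:~R &
       v <> w -> d = (fun=> 1) /\ forall f, x f = Qp_of_rat v (adjoint_one q f)].
  case: (pselect (v = w)) => [vw|vw].
    have vu : ~~ (v %| u)%Z by rewrite vw.
    by have [x [d [xd du]]] := diagonal_point vu; exists x, d.
  pose x : adjoint_group q (Qp v) := Qp_of_rat v \o adjoint_one q.
  by exists x, (fun=> 1); split=> //; apply: one_diagonal.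
pose y v := projT1 (cid (yP v)).
have yP' v : exists d, [/\ diagonal_at (y v) d, v = w -> d (ffconst i0) = u%:~R &
    v <> w -> d = (fun=> 1) /\ forall f, y v f = Qp_of_rat v (adjoint_one q f)].
  exact: projT2 (cid (yP v)).
pose d v := projT1 (cid (yP' v)).
have dP v : [/\ diagonal_at (y v) (d v), v = w -> d v (ffconst i0) = u%:~R &
    v <> w -> d v = (fun=> 1) /\ forall f, y v f = Qp_of_rat v (adjoint_one q f)].
  exact: projT2 (cid (yP' v)).
have fin f : finite_set [set v | ~ padic_int (y v f)].
  apply: (@sub_finite_set _ _ ([set w] `|`
      [set v | ~ padic_int (adele_of_rat S (adjoint_one q f) v)])).
    move=> v /= yv; apply: contrapT => /not_orP[vw /contrapT h]; apply: yv.
    by have [_ _ /(_ vw)[_ ->]] := dP v.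
  by rewrite finite_setU; split; [apply: finite_set1 | apply: adele_valP].
pose x f : adele S := @Adele S (fun v => y v f) (fin f).
have xz : zmod_morphism x by move=> f g; apply: adele_eq => v /=; rewrite rmorphB.
have xm : monoid_morphism x.
  by split=> [|f g]; apply: adele_eq => v /=; rewrite ?rmorph1 ?rmorphM.
exists (as_rmorphism xz xm), d; split=> [v||v vw].
- by have [h _ _] := dP v.
- by have [_ h _] := dP w; apply: h.
- by have [_ _ /(_ vw)[]] := dP v.
Qed.

(** Here x' = x h, so the monomials of h are diagonal with unit entries at all
    places, and the one at (i0, i0) is u' at w'.  A rational point y close to h
    then has integral monomials, so its monomial at (i0, i0) is an n-th power in
    Q(i), while it is congruent to u' at w'. *)
Lemma coset_separation (w' : place_off S) (u' : int) (l : nat)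
    (x x' : adjoint_group q (adele S))
    (d d' : forall v : place_off S, {ffun 'I_n -> 'I_n} -> Qp v)
    (h : adelic_points q S) :
  (forall p : prime_number, (p = 1 %[mod 4])%N -> exists v : place_off S, v = p :> prime_number) ->
  odd n -> (l %| n)%N ->
  (forall v, diagonal_at (local_point v x) (d v)) ->
  (forall v, diagonal_at (local_point v x') (d' v)) ->
  d w' = (fun=> 1) -> d' w' (ffconst i0) = u'%:~R ->
  ~~ (w' %| u')%Z -> (forall m : int, ~~ (w' %| m ^+ l - u')%Z) ->
  closure (rational_points q S) h -> ~ is_adjoint_mul x h x'.
Proof.
move=> off n_odd ln xd x'd dw' d'w' w'u' nonres hcl hmul.
pose t (v : place_off S) I K : Qp v := gauss_eval (JJ v) (gauss_map (local_point v h) (T I K)).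
have local_mul v : is_adjoint_mul (local_point v x) (local_point v h) (local_point v x').
  move=> f m a b fP; have := congr1 (@adele_at S v) (hmul f m a b fP).
  by rewrite rmorph_sum => e; apply: etrans e _; apply: eq_bigr => i _; rewrite rmorphM.
have tE v I K : d v I * t v I K = d' v I * (I == K)%:R.
  rewrite -(x'd v).2 (adjoint_mul_monomial q_nondeg n_gt0 I K (local_mul v)) rmorph_sum.
  rewrite (bigD1 I) //= big1 ?addr0 => [|K' K'I].
    by rewrite rmorphM /= (xd v).2 eqxx mulr1.
  by rewrite rmorphM /= (xd v).2 eq_sym (negPf K'I) mulr0 mul0r.
have tint (v : place_off S) I K : padic_int (t v I K).
  have [dI0 _ dV] := (xd v).1 I.
  have -> : t v I K = (d v I)^-1 * (d' v I * (I == K)%:R) by rewrite -tE mulKf.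
  apply: padic_intM; first by rewrite /padic_int -oppr0.
  apply: padic_intM; first by have [_] := (x'd v).1 I.
  exact: (padic_int_int v (I == K)%:Z).
have [y yP] := @closure_rational_approx n q S
  (bool * {ffun 'I_n -> 'I_n} * {ffun 'I_n -> 'I_n})%type
  (fun k => let: (b, M, N) := k in if b then gim (T M N) else gre (T M N)) h w' hcl.
pose phi (v : place_off S) : {rmorphism L -> Qp v} := padic_place (JJ v).
have near (v : place_off S) k I K :
    Qp_ball k (Qp_of_rat v (y (gre (T I K))) - h (gre (T I K)) v) ->
    Qp_ball k (Qp_of_rat v (y (gim (T I K))) - h (gim (T I K)) v) ->
    Qp_ball k (phi v (gauss_map y (T I K)) - t v I K).
  move=> re im; rewrite /phi /t /padic_place /gauss_eval /=.
  rewrite opprD addrACA -mulrBr; apply: Qp_ballD => //.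
  by rewrite mulrC; apply: Qp_ball_mulr; [exact: im | exact: J0].
have yint (v : place_off S) I K : padic_int (phi v (gauss_map y (T I K))).
  rewrite -(subrK (t v I K) (phi v _)); apply: Qp_ballD; last exact: tint.
  apply: (near v 0).
    by have [_] := yP (false, I, K); apply.
  by have [_] := yP (true, I, K); apply.
pose c := gauss_map y (T (ffconst i0) (ffconst i0)).
have cu : Qp_ball 1 (phi w' c - u'%:~R).
  have := tE w' (ffconst i0) (ffconst i0); rewrite dw' d'w' eqxx mulr1 mul1r => <-.
  apply: near; first by have [] := yP (false, ffconst i0, ffconst i0).
  by have [] := yP (true, ffconst i0, ffconst i0).
have c1 : ~ Qp_ball 1 (phi w' c).
  move=> c1; have := Qp_ballD c1 (Qp_ballN cu).
  by rewrite subKr => /Qp_ball_int1; apply/negP.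
have c0 : c != 0 by apply/eqP => c0; apply: c1; rewrite c0 /phi rmorph0; apply: Qp_ball0.
have [z zE] : exists z : L, c = z ^+ n.
  apply: rational_monomial_power => // p /off[v vp].
  by case: p / vp; exists (J v), (JJ v); split; [exact: J0 | move=> I K; exact: yint].
have phi0 : phi w' c != 0 by rewrite fmorph_eq0.
have [k kP] : exists k, has_val (phi w' z) k.
  apply: has_val_exists; rewrite fmorph_eq0; apply: contraNneq c0 => z0.
  by rewrite zE z0 expr0n gtn_eqF // eqxx.
have cP : has_val (phi w' c) (k *+ n) by rewrite zE rmorphXn; apply: has_valX.
have k0 : 0 <= k.
  have : 0 <= k *+ n by apply/(has_val_ge _ cP); apply: yint.
  by rewrite pmulrn_lge0.
have zint : padic_int (phi w' z) by apply/(has_val_ge _ kP).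
have [m mP] := padic_int_residue zint.
have : Qp_ball 1 ((m ^+ n - u')%:~R : Qp w').
  rewrite rmorphB rmorphXn /=.
  rewrite -[_ - _](subrK (phi w' c - u'%:~R)); apply: Qp_ballD => //.
  rewrite opprB addrA subrK zE rmorphXn /= -opprB subrXX; apply: Qp_ballN.
  apply: Qp_ball_mulr => //.
  elim/big_ind: _ => [|a b|i _]; [exact: Qp_ball0|exact: Qp_ballD|].
  by apply: padic_intM; apply: padic_intX => //; apply: padic_int_int.
case/dvdnP: ln => e ->; rewrite exprM => /Qp_ball_int1.
exact/negP.
Qed.
End AdelicPointsOfG.

Lemma finite_nat_bounded (A : set nat) : finite_set A -> exists K, forall k, A k -> (k <= K)%N.
Proof.
move=> /finite_seqP[s ->]; exists (\max_(k <- s) k) => k /= ks.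
exact: (@leq_bigmax_seq _ s xpredT id).
Qed.

Theorem theorem7p1 (n : nat) (n_ge3 : (3 <= n)%N) (n_odd : odd n)
    (q : {hermitian 'rV[L]_n for false & sigma}) (q_nondeg : nondegenerate q) :
  let S : set place :=
    [set v_infty]
    `|` [set v_fin p | p in [set p : prime_number | p = 2%N :> nat]]
    `|` [set v_fin p | p in [set p : prime_number | (p = 3 %[mod 4])%N]] in
  infinite_set (approximation_cosets q S) /\
  ~ almost_strong_approximation q S.
Proof.
move=> S.
suff infinite : infinite_set (approximation_cosets q S) by split.
have SE (p : prime_number) : S (v_fin p) <-> (p = 2%N :> nat) \/ (p = 3 %[mod 4])%N.
  split=> [[[//|]|]|[p2|p3]]; first by case=> p' p'2 [<-]; left.
  - by case=> p' p'3 [<-]; right.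
  - by left; right; exists p.
  - by right; exists p.
have place1 (v : place_off S) : (v = 1 %[mod 4])%N.
  case: v => v /=; rewrite SE => /not_orP[v2 v3].
  have := even_prime (prime_valP v); lia.
have off (p : prime_number) : (p = 1 %[mod 4])%N -> exists v : place_off S, v = p :> prime_number.
  move=> p1; have pS : ~ S (v_fin p).
    by rewrite SE => -[p2|p3]; [rewrite p2 in p1|rewrite p3 in p1].
  by exists (PlaceOff pS).
have n_gt0 : (0 < n)%N by apply: leq_trans n_ge3.
pose l := pdiv n; have l_pr : prime l by apply: pdiv_prime; apply: leq_trans n_ge3.
have ln : (l %| n)%N by apply: pdiv_dvd.
have l_odd : odd l.
  by case/dvdnP: ln n_odd => k ->; rewrite oddM => /andP[].
have JP (v : place_off S) : exists J : Qp v, J ^+ 2 = -1 /\ padic_int J.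
  have v4 : (4 %| v.-1)%N by have := place1 v; lia.
  have [g gP] := sqrtN1_mod (prime_valP v) v4.
  have v_odd : odd v by have := place1 v; lia.
  by have [J JJ J0] := sqrtN1_padic v_odd gP; exists J.
pose J v := projT1 (cid (JP v)).
have JJ v : J v ^+ 2 = -1 by have [] := projT2 (cid (JP v)).
have J0 v : padic_int (J v) by have [] := projT2 (cid (JP v)).
pose i0 := Ordinal n_gt0; pose i1 := Ordinal (leq_trans (isT : 1 < 3)%N n_ge3).
have i01 : i0 != i1 by [].
(* Places off S are 1 modulo 4, so these are 1 modulo 4 l. *)
pose W := {v : place_off S | (l %| v.-1)%N}.
have uP (w : W) : exists2 u : int, ~~ (val w %| u)%Z & forall m : int, ~~ (val w %| m ^+ l - u)%Z.
  by apply: power_nonresidue (prime_valP _) _ (prime_gt1 l_pr) (valP w).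
pose u w := projT1 (cid2 (uP w)).
have u_unit w : ~~ (val w %| u w)%Z by rewrite /u; case: cid2.
have u_nonres w : forall m : int, ~~ (val w %| m ^+ l - u w)%Z by rewrite /u; case: cid2.
have xP (w : W) := supported_point q_nondeg n_gt0 JJ i01 (u_unit w).
pose x w := projT1 (cid (xP w)).
have xdP w : exists d : forall v : place_off S, {ffun 'I_n -> 'I_n} -> Qp v,
    [/\ forall v, diagonal_at q_nondeg n_gt0 JJ (local_point v (x w)) (d v),
        d (val w) (ffconst i0) = (u w)%:~R & forall v, v <> val w -> d v = fun=> 1].
  exact: projT2 (cid (xP w)).
pose H := closure (rational_points q S).
have x_inj : injective (fun w => left_coset H (x w)).
  move=> w w' /= E; apply: contrapT => ww'.
  have : left_coset H (x w') (x w').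
    exists (adele_of_rat S \o adjoint_one q : adjoint_group q (adele S)).
      by apply: subset_closure; exists (adjoint_one q).
    exact: (@is_adjoint_mul_one n q _ (adele_of_rat S)).
  rewrite -E => -[h hH hmul].
  have [d [dx _ d1]] := xdP w; have [d' [dx' d'u _]] := xdP w'.
  have ww : val w' <> val w by move/val_inj/esym.
  exact: (coset_separation J0 off n_odd ln dx dx' (d1 _ ww) d'u (u_unit w') (u_nonres w') hH hmul).
move=> fin.
have Wfin : finite_set [set: W].
  apply: (@sub_finite_set _ _ ((fun w => left_coset H (x w)) @^-1` approximation_cosets q S)).
    by move=> w _; exists (x w).
  by apply: finite_preimage => // w w' _ _; apply: x_inj.
have [K KP] := finite_nat_bounded (finite_image (fun w : W => val w : nat) Wfin).
have [p [p_pr Kp p1]] := prime_1mod4l_above K l_pr l_odd.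
have p4 : (p = 1 %[mod 4])%N.
  have : (4 %| p.-1)%N by apply: dvdn_trans p1; apply: dvdn_mulr.
  by have := prime_gt0 p_pr; lia.
have [v vp] := off (Prime p_pr) p4.
have vl : (l %| v.-1)%N by rewrite vp /=; apply: dvdn_trans p1; apply: dvdn_mull.
suff : (p <= K)%N by rewrite leqNgt Kp.
by apply: KP; exists (exist _ v vl : W) => //=; rewrite vp.
Qed.
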